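(* Let $n>m\ge1$, $R>0$, and let $F:C_{R+1}\to\mathbb{R}^m$ be a continuous Gaussian random field satisfying the $(R;M,k_1)$-assumptions on $C_{R+1}$. Then there is $\delta=\delta(n,m,M,k_1)\in(0,1)$ such that whenever $x\in C_R$ and $\|x-y\|\le\delta$, for every $\eta\in\mathbb{S}^{m-1}\subset\mathbb{R}^m$, $\eta^T\big(\mathrm{Cov}(y,y)-\mathrm{Cov}(y,x)\mathrm{Cov}(x,x)^{-1}\mathrm{Cov}(x,y)\big)\eta\ge\frac{k_1}{2}\|y-x\|^2.$ In particular, there is $k_2=k_2(n,m,M,k_1)>0$ such that for $x\in C_R$ and $0<\|x-y\|<\delta$, the joint distribution of $(F(x),F(y))$ is non-degenerate and $p_{(F(x),F(y))}(0,0)\le\frac{k_2}{\|x-y\|^m}$.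
   Context: $C_R=(-R,R)^n$. $F=(f_1,\dots,f_m)$, $\mathrm{Cov}(x,y)$ is the $m\times m$ matrix $(\mathcal{E}(f_{i_1}(x)f_{i_2}(y)))$, $K_{i_1i_2}(x,y)=\mathcal{E}(f_{i_1}(x)f_{i_2}(y))$, and $p_{(F(x),F(y))}(0,0)$ is the density of $(F(x),F(y))$ at $(0,0)$. The $(R;M,k_1)$-assumptions: (A1) $F$ centered and $\mathcal{E}|\sum_i\eta_if_i(x)+\sum_{i,j}\xi_{ij}\partial_jf_i(x)|^2\ge k_1>0$ for all $x\in C_{R+1}$ and unit $(\eta,\xi)\in\mathbb{R}^m\times\mathbb{R}^{nm}$; (A2) $F$ a.s. $C^{3-}=\bigcap_{0<\beta<1}C^{2+\beta}$ on $C_{R+1}$ and $\max_{0\le|\alpha|\le3}\sup_{x\in C_{R+1}}|D_x^\alpha D_y^\alpha K_{i_1i_2}(x,y)|_{y=x}|\le M$. *)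

(* Defs.v *)
From HB Require Import structures.
From mathcomp Require Import all_boot all_order all_algebra.
From mathcomp Require Import all_classical all_reals all_analysis.
Set Implicit Arguments. Unset Strict Implicit. Unset Printing Implicit Defensive.
Import Order.TTheory GRing.Theory Num.Theory.
Import numFieldNormedType.Exports.
Local Open Scope classical_set_scope.
Local Open Scope ring_scope.

Section Defs.
Context {R : realType} {n m : nat}.

Definition enorm {k : nat} (x : 'rV[R]_k) : R := Num.sqrt (\sum_(j < k) x 0 j ^+ 2).

Definition cube (r : R) : set 'rV[R]_n := [set x | forall j : 'I_n, - r < x 0 j < r].

Definition ev (j : 'I_n) : 'rV[R]_n := delta_mx 0 j.
Definition pd (j : 'I_n) (g : 'rV[R]_n -> R) : 'rV[R]_n -> R :=
  fun x => 'D_(ev j) g x.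

Definition Dalpha (alpha : 'I_n -> nat) (g : 'rV[R]_n -> R) : 'rV[R]_n -> R :=
  foldr (fun j h => iter (alpha j) (pd j) h) g (enum 'I_n).
Definition mi_order (alpha : 'I_n -> nat) : nat := (\sum_(j < n) alpha j)%N.

Definition holder_on (beta : R) (U : set 'rV[R]_n) (h : 'rV[R]_n -> R) :=
  exists C : R, forall x y, U x -> U y -> `|h x - h y| <= C * (enorm (x - y)) `^ beta.

Definition C2beta (beta : R) (U : set 'rV[R]_n) (g : 'rV[R]_n -> R) :=
  [/\ forall x, U x -> differentiable g x,
      forall (j : 'I_n) x, U x -> differentiable (pd j g) x &
      forall j k : 'I_n, holder_on beta U (pd k (pd j g))].

Definition C3minus (U : set 'rV[R]_n) (g : 'rV[R]_n -> R) :=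
  forall beta : R, 0 < beta < 1 -> C2beta beta U g.

Section Prob.
Context {d : measure_display} {T : measurableType d} (P : probability T R).

Definition centered_gaussian (X : T -> R) :=
  measurable_fun setT X /\
  exists s : R, 0 <= s /\ forall A : set R, measurable A ->
    P (X @^-1` A) = (if s == 0 then \d_(0:R) A else normal_prob 0 s A).

Definition centered_gaussian_field (U : set 'rV[R]_n)
    (f : 'I_m -> 'rV[R]_n -> T -> R) :=
  forall (k : nat) (pts : 'I_k -> 'rV[R]_n) (idx : 'I_k -> 'I_m) (c : 'I_k -> R),
    (forall l, U (pts l)) ->
    centered_gaussian (fun w => \sum_(l < k) c l * f (idx l) (pts l) w).

Definition as_continuous (U : set 'rV[R]_n) (f : 'I_m -> 'rV[R]_n -> T -> R) :=
  forall i : 'I_m, {ae P, forall w, {within U, continuous (fun x => f i x w)}}.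

Definition Kcov (f : 'I_m -> 'rV[R]_n -> T -> R) (i1 i2 : 'I_m) (x y : 'rV[R]_n) : R :=
  fine (('E_P[fun w => (f i1 x w * f i2 y w)%R])%E).

Definition Cov (f : 'I_m -> 'rV[R]_n -> T -> R) (x y : 'rV[R]_n) : 'M[R]_m :=
  \matrix_(i1, i2) Kcov f i1 i2 x y.

Definition jointCov (f : 'I_m -> 'rV[R]_n -> T -> R) (x y : 'rV[R]_n) : 'M[R]_(m + m) :=
  block_mx (Cov f x x) (Cov f x y) (Cov f y x) (Cov f y y).

(** Density at (0,0) of the (non-degenerate) centered Gaussian vector (F(x),F(y)):
    (2 pi)^{-2m/2} det(Sigma)^{-1/2}. *)
Definition density00 (f : 'I_m -> 'rV[R]_n -> T -> R) (x y : 'rV[R]_n) : R :=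
  ((pi *+ 2) ^+ m * Num.sqrt (\det (jointCov f x y)))^-1.

(** (A1): F centered and non-degeneracy of (F(x), grad F(x)) on C_{r+1}. *)
Definition assumptionA1 (r k1 : R) (f : 'I_m -> 'rV[R]_n -> T -> R) :=
  (forall i x, cube (r + 1) x -> ('E_P[f i x])%E = 0%E) /\
  0 < k1 /\
  forall x, cube (r + 1) x ->
  forall (eta : 'rV[R]_m) (xi : 'M[R]_(m, n)),
    \sum_(i < m) eta 0 i ^+ 2 + \sum_(i < m) \sum_(j < n) xi i j ^+ 2 = 1 ->
    (k1%:E <= ('E_P[fun w => ((\sum_(i < m) eta 0 i * f i x w
        + \sum_(i < m) \sum_(j < n) xi i j * pd j (fun z => f i z w) x) ^+ 2)%R])%E)%E.

Definition assumptionA2 (r M : R) (f : 'I_m -> 'rV[R]_n -> T -> R) :=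
  (forall i : 'I_m, {ae P, forall w, C3minus (cube (r + 1)) (fun x => f i x w)}) /\
  forall (alpha : 'I_n -> nat), (mi_order alpha <= 3)%N ->
  forall (i1 i2 : 'I_m) x, cube (r + 1) x ->
    `| Dalpha alpha (fun x' => Dalpha alpha (fun y' => Kcov f i1 i2 x' y') x) x | <= M.

Definition RMk1_assumptions (r M k1 : R) (f : 'I_m -> 'rV[R]_n -> T -> R) :=
  assumptionA1 r k1 f /\ assumptionA2 r M f.

End Prob.
End Defs.

Definition quadf {R : realType} {k : nat} (eta : 'rV[R]_k) (A : 'M[R]_k) : R :=
  (eta *m A *m eta^T) 0 0.

(* Main.v *)
Require Import Defs.
From HB Require Import structures.
From mathcomp Require Import all_boot all_order all_algebra.
From mathcomp Require Import all_classical all_reals all_analysis.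
From mathcomp Require Import measurable_realfun ring lra.
Import Order.TTheory GRing.Theory Num.Theory.
Import numFieldNormedType.Exports.
Local Open Scope classical_set_scope.
Local Open Scope ring_scope.

(** A finite linear combination of values of F is a centered Gaussian variable,
    so its second moment is bounded as soon as the expectation of its square
    truncated at 1 is small. This property passes to pointwise limits and turns
    pointwise convergence inside a linear space of such variables into
    convergence in mean square. Hence the almost sure first and second
    derivatives of F are derivatives in mean square, and assumption (A2) bounds
    the second moments of the second derivatives by M.

    Moving from x to y one coordinate at a time gives the mean-square Taylor
    estimate F(y) = F(x) + DF(x)(y - x) + O(|y - x|^2). The quadratic form of the
    Schur complement at eta is E|zeta F(x) + eta F(y)|^2 for a suitable zeta, and
    this is E|(zeta + eta) F(x) + eta DF(x)(y - x)|^2 up to the Taylor remainder,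
    so (A1) gives the lower bound. The determinant of the joint covariance is
    det Cov(x,x) times that of the Schur complement. *)

Set Implicit Arguments. Unset Strict Implicit. Unset Printing Implicit Defensive.

(** * Square-integrable random variables *)

Section SquareIntegrable.
Context {R : realType} {d : measure_display} {T : measurableType d}.
Variable P : probability T R.
Implicit Types X Y Z : T -> R.

(** Functions rather than classes modulo null sets, because the limits taken later are pointwise at
    every sample point. *)
Definition L2 X :=
  measurable_fun setT X /\ P.-integrable setT (EFin \o (fun w => X w ^+ 2)).

Definition ip X Y : R := \int[P]_w (X w * Y w).

Definition nrm X : R := Num.sqrt (ip X X).

Lemma integrable_le X Y : measurable_fun setT X ->
  P.-integrable setT (EFin \o Y) -> (forall w, `|X w| <= Y w) ->
  P.-integrable setT (EFin \o X).
Proof.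
move=> mX iY XY; apply: le_integrable iY => //; first exact/measurable_EFinP.
by move=> w _ /=; rewrite lee_fin (le_trans (XY w))// ler_norm.
Qed.

Lemma L2_mul X Y : L2 X -> L2 Y ->
  P.-integrable setT (EFin \o (fun w => X w * Y w)).
Proof.
move=> [mX iX] [mY iY].
apply: (@integrable_le _ (fun w => X w ^+ 2 + Y w ^+ 2)).
- exact: measurable_funM.
- exact: (integrableD _ iX iY).
- by move=> w; rewrite ler_norml; apply/andP; split; nra.
Qed.

Lemma L2_lin a X Y : L2 X -> L2 Y -> L2 (fun w => a * X w + Y w).
Proof.
move=> LX LY; case: (LX) => mX iX; case: (LY) => mY iY.
have mXY : measurable_fun setT (fun w => a * X w + Y w).
  by apply: measurable_funD => //; exact: measurable_funM.
split => //.
apply: (@integrable_le _ (fun w => (2 * a ^+ 2) * X w ^+ 2 + 2 * Y w ^+ 2)).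
- exact: measurable_funX.
- exact: (integrableD _ (integrableZl _ (2 * a ^+ 2) iX) (integrableZl _ 2 iY)).
- move=> w; rewrite ger0_norm ?sqr_ge0//.
  have := sqr_ge0 (a * X w - Y w); nra.
Qed.

Lemma L2_0 : L2 (fun=> 0).
Proof.
split; first exact: measurable_cst.
by under eq_fun do rewrite expr0n/=; exact: integrable0.
Qed.

Lemma L2Z a X : L2 X -> L2 (fun w => a * X w).
Proof.
move=> LX; have := L2_lin a LX L2_0.
by congr L2; apply/funext => w; rewrite addr0.
Qed.

Lemma L2D X Y : L2 X -> L2 Y -> L2 (fun w => X w + Y w).
Proof.
move=> LX LY; have := L2_lin 1 LX LY.
by congr L2; apply/funext => w; rewrite mul1r.
Qed.

Lemma L2B X Y : L2 X -> L2 Y -> L2 (fun w => X w - Y w).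
Proof.
move=> LX LY; have := L2_lin (-1) LY LX.
by congr L2; apply/funext => w; rewrite mulN1r addrC.
Qed.

Lemma L2_sum (I : Type) (s : seq I) (Q : pred I) (X : I -> T -> R) :
  (forall i, L2 (X i)) -> L2 (fun w => \sum_(i <- s | Q i) X i w).
Proof.
move=> LX; elim: s => [|i s IH].
  by under eq_fun do rewrite big_nil; exact: L2_0.
under eq_fun do rewrite big_cons; case: (Q i) => //.
exact: L2D.
Qed.

Lemma ipC X Y : ip X Y = ip Y X.
Proof. by rewrite /ip; apply: eq_Rintegral => w _; rewrite mulrC. Qed.

Lemma ipDr Z X Y : L2 Z -> L2 X -> L2 Y ->
  ip Z (fun w => X w + Y w) = ip Z X + ip Z Y.
Proof.
move=> LZ LX LY; rewrite /ip -RintegralD//; try exact: L2_mul.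
by apply: eq_Rintegral => w _; rewrite mulrDr.
Qed.

Lemma ipZr Z a X : L2 Z -> L2 X -> ip Z (fun w => a * X w) = a * ip Z X.
Proof.
move=> LZ LX; rewrite /ip -RintegralZl//; last exact: L2_mul.
by apply: eq_Rintegral => w _; rewrite mulrCA.
Qed.

Lemma ipBr Z X Y : L2 Z -> L2 X -> L2 Y ->
  ip Z (fun w => X w - Y w) = ip Z X - ip Z Y.
Proof.
move=> LZ LX LY; rewrite /ip -RintegralB//; try exact: L2_mul.
by apply: eq_Rintegral => w _; rewrite mulrBr.
Qed.

Lemma ip_sumr (I : Type) (s : seq I) Z (X : I -> T -> R) : L2 Z ->
  (forall i, L2 (X i)) ->
  ip Z (fun w => \sum_(i <- s) X i w) = \sum_(i <- s) ip Z (X i).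
Proof.
move=> LZ LX; elim: s => [|i s IH].
  rewrite big_nil /ip; under eq_Rintegral do rewrite big_nil mulr0.
  by rewrite Rintegral_cst// mul0r.
rewrite big_cons -IH -ipDr//; last exact: L2_sum.
by congr ip; apply/funext => w; rewrite big_cons.
Qed.

Lemma ip_ge0 X : 0 <= ip X X.
Proof. by apply: Rintegral_ge0 => w _; rewrite -expr2 sqr_ge0. Qed.

Lemma nrm_ge0 X : 0 <= nrm X. Proof. exact: sqrtr_ge0. Qed.

Lemma sqr_nrm X : nrm X ^+ 2 = ip X X.
Proof. by rewrite sqr_sqrtr ?ip_ge0. Qed.

Lemma nrm_le X (B : R) : 0 <= B -> ip X X <= B ^+ 2 -> nrm X <= B.
Proof.
by move=> B0 XB; rewrite /nrm -(ger0_norm B0) -sqrtr_sqr ler_wsqrtr.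
Qed.

Lemma ip_lin X Y a b : L2 X -> L2 Y ->
  ip (fun w => a * X w + b * Y w) (fun w => a * X w + b * Y w) =
  a ^+ 2 * ip X X + 2 * a * b * ip X Y + b ^+ 2 * ip Y Y.
Proof.
move=> LX LY.
have LaX := L2Z a LX; have LbY := L2Z b LY; have LS := L2D LaX LbY.
rewrite ipDr// !ipZr// ![ip _ X]ipC ![ip _ Y]ipC !ipDr// !ipZr//.
rewrite (ipC Y X); ring.
Qed.

Lemma ip_cauchy_schwarz X Y : L2 X -> L2 Y -> `|ip X Y| <= nrm X * nrm Y.
Proof.
move=> LX LY; rewrite /nrm -sqrtrM ?ip_ge0// -sqrtr_sqr ler_wsqrtr//.
have X0 := ip_ge0 X; have Y0 := ip_ge0 Y.
(* When [Y] has nonzero norm, expand the squared norm of [ip Y Y * X - ip X Y * Y]. *)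
have [y0|y0] := eqVneq (ip Y Y) 0; last first.
  have yp : 0 < ip Y Y by rewrite lt_neqAle eq_sym y0.
  have := ip_ge0 (fun w => ip Y Y * X w + (- ip X Y) * Y w).
  rewrite ip_lin// => h.
  have : 0 <= ip Y Y * (ip X X * ip Y Y - ip X Y ^+ 2) by nra.
  by rewrite pmulr_rge0// subr_ge0.
(* With [Y] of norm zero the quadratic in [t] degenerates to an affine function. It stays
   nonnegative only if its slope vanishes: otherwise the [t] used below would give the value -1. *)
have h t : 0 <= ip X X + 2 * t * ip X Y.
  have := ip_ge0 (fun w => 1 * X w + t * Y w).
  by rewrite ip_lin// y0; nra.
rewrite y0 mulr0.
have [->|xy0] := eqVneq (ip X Y) 0; first by rewrite expr0n.
have := h (- (ip X X + 1) / (2 * ip X Y)).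
have -> : 2 * (- (ip X X + 1) / (2 * ip X Y)) * ip X Y = - (ip X X + 1).
  by field.
lra.
Qed.

Lemma nrmD X Y : L2 X -> L2 Y -> nrm (fun w => X w + Y w) <= nrm X + nrm Y.
Proof.
move=> LX LY; apply: nrm_le; first by rewrite addr_ge0// nrm_ge0.
have -> : (fun w => X w + Y w) = (fun w => 1 * X w + 1 * Y w).
  by apply/funext => w; rewrite !mul1r.
rewrite ip_lin// sqrrD !sqr_nrm.
have := ip_cauchy_schwarz LX LY; have := ler_norm (ip X Y); lra.
Qed.

Lemma nrmZ a X : L2 X -> nrm (fun w => a * X w) = `|a| * nrm X.
Proof.
move=> LX; rewrite /nrm ipZr//; last exact: L2Z.
rewrite ipC ipZr// mulrA -expr2 sqrtrM ?sqr_ge0//.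
by rewrite sqrtr_sqr.
Qed.

Lemma nrm_sum (I : Type) (s : seq I) (X : I -> T -> R) :
  (forall i, L2 (X i)) ->
  nrm (fun w => \sum_(i <- s) X i w) <= \sum_(i <- s) nrm (X i).
Proof.
move=> LX; elim: s => [|i s IH].
  rewrite big_nil; apply: nrm_le => //.
  rewrite /ip; under eq_Rintegral do rewrite big_nil mulr0.
  by rewrite Rintegral_cst// mul0r expr0n.
rewrite big_cons; under eq_fun do rewrite big_cons.
by apply: le_trans (nrmD _ _) _ => //; [exact: L2_sum|rewrite lerD2l].
Qed.

End SquareIntegrable.

(** * Pointwise limits of coercive families *)

Section CoerciveClass.
Context {R : realType} {d : measure_display} {T : measurableType d}.
Variable P : probability T R.
Implicit Types (X Y : T -> R) (G : (T -> R) -> Prop).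

(** The integrand is bounded by 1, so this quantity passes to pointwise limits by dominated
    convergence, with no prior control of the second moment. *)
Definition truncated_moment X : R := \int[P]_w Num.min 1 (X w ^+ 2).

(* [G] is stable under scaling, so the third field controls the second moment
   at every scale. *)
Record coercive (c : R) G : Prop := Coercive {
  coercive_L2 : forall X, G X -> L2 P X;
  coercive_lin : forall a X Y, G X -> G Y -> G (fun w => a * X w + Y w);
  coercive_bound : forall X, G X -> truncated_moment X < c -> ip P X X <= 1 }.

(** A single step of sequential closure. It is iterated once per order of differentiation, since
    each derivative is a limit of difference quotients. *)
Definition seq_closure G : (T -> R) -> Prop := fun X =>
  exists X_ : nat -> T -> R,
    (forall n, G (X_ n)) /\ forall w, X_ n w @[n --> \oo] --> X w.

Lemma measurable_trunc X : measurable_fun setT X ->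
  measurable_fun setT (fun w => Num.min 1 (X w ^+ 2)).
Proof.
move=> mX; apply: measurable_minr; first exact: measurable_cst.
exact: measurable_funX.
Qed.

Lemma trunc_ge0 (x : R) : 0 <= Num.min 1 (x ^+ 2).
Proof. by rewrite le_min ler01 sqr_ge0. Qed.

Lemma integrable_trunc X : measurable_fun setT X ->
  P.-integrable setT (EFin \o (fun w => Num.min 1 (X w ^+ 2))).
Proof.
move=> mX; apply: (@integrable_le _ _ _ _ _ (cst 1)).
- exact: measurable_trunc.
- exact: finite_measure_integrable_cst.
- by move=> w; rewrite ger0_norm ?trunc_ge0// ge_min lexx.
Qed.

Lemma truncated_moment_cvg (X_ : nat -> T -> R) X :
  (forall n, measurable_fun setT (X_ n)) -> measurable_fun setT X ->
  (forall w, X_ n w @[n --> \oo] --> X w) ->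
  truncated_moment (X_ n) @[n --> \oo] --> truncated_moment X.
Proof.
move=> mX_ mX XX.
(* Written with an absolute value, the truncation is visibly continuous, and its limit follows from
   the arithmetic of limits. *)
have minE (x : R) : Num.min 1 (x ^+ 2) = 2^-1 * (1 + x * x - `|1 - x * x|).
  by rewrite minr_absE -expr2 mulrC.
have cX : {ae P, forall w, setT w ->
    (fun n => (Num.min 1 (X_ n w ^+ 2))%:E) @ \oo --> (Num.min 1 (X w ^+ 2))%:E}.
  apply/aeW => w _; apply: cvg_EFin; first exact: nearW.
  under eq_cvg do rewrite /= minE; rewrite minE.
  have X2 : X_ n w * X_ n w @[n --> \oo] --> X w * X w by exact: cvgM.
  apply: cvgMr.
  exact: cvgB (cvgD (cvg_cst _) X2) (cvg_norm (cvgB (cvg_cst _) X2)).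
have bX : {ae P, forall w n, setT w ->
    (`|(Num.min 1 (X_ n w ^+ 2))%:E| <= (cst 1 w)%:E)%E}.
  apply/aeW => w n _ /=.
  by rewrite lee_fin ger0_norm ?trunc_ge0// ge_min lexx.
have [_ _ H] := dominated_convergence measurableT
  (fun n => (measurable_EFinP _ _).2 (measurable_trunc (mX_ n)))
  ((measurable_EFinP _ _).2 (measurable_trunc mX)) cX
  (finite_measure_integrable_cst P 1 measurableT) bX.
apply: fine_cvg; rewrite fineK; last first.
  by apply: integrable_fin_num => //; exact: integrable_trunc.
exact: H.
Qed.

(** A substitute for the triangle inequality: the bound of [(x - y)^2] by [2 x^2 + 2 y^2] survives
    truncation at 1. *)
Lemma truncated_momentB X Y : measurable_fun setT X -> measurable_fun setT Y ->
  truncated_moment (fun w => X w - Y w) <=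
  2 * truncated_moment X + 2 * truncated_moment Y.
Proof.
move=> mX mY; rewrite /truncated_moment.
have iX := integrable_trunc mX; have iY := integrable_trunc mY.
rewrite -!RintegralZl// -RintegralD//.
- apply: le_Rintegral => //.
  + by apply: integrable_trunc; exact: measurable_funB.
  + exact: (integrableD _ (integrableZl _ 2 iX) (integrableZl _ 2 iY)).
  + move=> w _; have h : (X w - Y w) ^+ 2 <= 2 * X w ^+ 2 + 2 * Y w ^+ 2.
      have := sqr_ge0 (X w + Y w); nra.
    have := sqr_ge0 (X w); have := sqr_ge0 (Y w).
    rewrite !minEle; do 3 case: ifP => /= ?; lra.
- exact: (integrableZl _ 2 iX).
- exact: (integrableZl _ 2 iY).
Qed.

(** Fatou's lemma for the squares, whose lower limit is the square of the pointwise limit. *)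
Lemma fatou_ip (X_ : nat -> T -> R) X (C : R) :
  (forall n, L2 P (X_ n)) -> (forall w, X_ n w @[n --> \oo] --> X w) ->
  (forall n, ip P (X_ n) (X_ n) <= C) -> L2 P X /\ ip P X X <= C.
Proof.
move=> LX XX XC.
have mX : measurable_fun setT X.
  by apply: (@measurable_fun_cvg _ _ _ setT X_) => // n; have [] := LX n.
have mX2 n : measurable_fun setT (fun w => (X_ n w ^+ 2)%:E).
  by apply/measurable_EFinP/measurable_funX; have [] := LX n.
have := @fatou _ T R P setT measurableT (fun n w => (X_ n w ^+ 2)%:E) mX2.
have -> : (\int[P]_(x in setT) limn_einf (fun n => (X_ n x ^+ 2)%:E) =
           \int[P]_x (X x ^+ 2)%:E)%E.
  apply: eq_integral => w _.
  have h : (X_ n w ^+ 2)%:E @[n --> \oo] --> (X w ^+ 2)%:E.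
    apply: cvg_EFin; first exact: nearW.
    by under eq_cvg do rewrite /= expr2; rewrite expr2; exact: cvgM.
  by have [-> _] := cvg_limn_einf_sup h.
move=> F.
have {F} le : (\int[P]_x (X x ^+ 2)%:E <= C%:E)%E.
  apply: le_trans (F _) _; first by move=> n w _; rewrite lee_fin sqr_ge0.
  rewrite limn_einf_lim; apply: lime_le; first exact: is_cvg_einfs.
  apply: nearW => n; apply: (@le_trans _ _ (\int[P]_x (X_ n x ^+ 2)%:E)%E).
    by apply: ereal_inf_lbound; exists n => //=.
  have [_ iX] := LX n.
  rewrite -[leLHS]fineK; first by rewrite lee_fin; have := XC n.
  exact: integrable_fin_num.
have LX' : L2 P X.
  split => //; apply/integrableP; split.
    by apply/measurable_EFinP; exact: measurable_funX.
  under eq_integral do rewrite /= ger0_norm ?sqr_ge0//.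
  exact: le_lt_trans le (ltry _).
split => //; rewrite -lee_fin; apply: le_trans le.
by rewrite /ip /Rintegral fineK//; have [_] := LX'; exact: integrable_fin_num.
Qed.

Section Closure.
Variables (c : R) (G : (T -> R) -> Prop).
Hypotheses (c0 : 0 < c) (HG : coercive c G).

Lemma coerciveZ a X : G X -> G (fun w => a * X w).
Proof.
move=> GX; have := coercive_lin HG (a - 1) GX GX.
by congr G; apply/funext => w; rewrite mulrBl mul1r subrK.
Qed.

Lemma coerciveB X Y : G X -> G Y -> G (fun w => X w - Y w).
Proof.
move=> GX GY; have := coercive_lin HG (-1) GY GX.
by congr G; apply/funext => w; rewrite mulN1r addrC.
Qed.

Lemma coercive_meas X : G X -> measurable_fun setT X.
Proof. by move=> /(coercive_L2 HG)[]. Qed.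

(** For fixed [K], the truncated moment of [K (X_n - X)] tends to 0, so that of [K (X_n - X_m)] is
    below [c] for large [n] and [m]. Coercivity bounds its second moment by 1, and Fatou in [m]
    gives the norm of [X_n - X] at most [1/K]. *)
Lemma coercive_cvg (X_ : nat -> T -> R) X :
  (forall n, G (X_ n)) -> (forall w, X_ n w @[n --> \oo] --> X w) ->
  L2 P X /\ nrm P (fun w => X_ n w - X w) @[n --> \oo] --> (0 : R).
Proof.
move=> GX XX.
have mX : measurable_fun setT X.
  by apply: (@measurable_fun_cvg _ _ _ setT X_) => // n; exact: coercive_meas.
have key K : 0 < K -> exists N, forall n, (N <= n)%N ->
    L2 P (fun w => K * (X_ n w - X w)) /\ nrm P (fun w => K * (X_ n w - X w)) <= 1.
  move=> K0.
  have t0 : truncated_moment (fun w => K * (X_ n w - X w)) @[n --> \oo] --> (0 : R).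
    have -> : 0 = truncated_moment (fun=> 0).
      rewrite /truncated_moment; under eq_Rintegral do
        rewrite expr0n/= minEle real_leNgt ?num_real// ltr01.
      by rewrite Rintegral_cst// mul0r.
    apply: truncated_moment_cvg => [n||w]; last 2 first.
    - exact: measurable_cst.
    - rewrite -(mulr0 K); apply: cvgMr; rewrite -(subrr (X w)).
      exact: cvgB (XX w) (cvg_cst _).
    apply: measurable_funM => //; apply: measurable_funB => //.
    exact: coercive_meas.
  (* Two terms, each doubled by [truncated_momentB], must add up to less than [c]. *)
  have c4 : 0 < c / 4 by rewrite divr_gt0.
  have /cvgrPdist_lt/(_ _ c4)[N _ hN] := t0.
  have hN' n : (N <= n)%N -> truncated_moment (fun w => K * (X_ n w - X w)) < c / 4.
    by move=> /hN; rewrite sub0r normrN => /(le_lt_trans (ler_norm _)).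
  exists N => n Nn.
  have [] := @fatou_ip (fun m w => K * (X_ n w - X_ (m + N)%N w))
               (fun w => K * (X_ n w - X w)) 1.
  - by move=> m; apply: (coercive_L2 HG); apply: coerciveZ; exact: coerciveB.
  - move=> w; apply: cvgMr; apply: cvgB (cvg_cst _) _.
    by rewrite (cvg_shiftn N (fun m => X_ m w)).
  - move=> m; apply: (coercive_bound HG).
      by apply: coerciveZ; exact: coerciveB.
    have -> : (fun w => K * (X_ n w - X_ (m + N)%N w)) =
        (fun w => K * (X_ n w - X w) - K * (X_ (m + N)%N w - X w)).
      by apply/funext => w; ring.
    have mK k : measurable_fun setT (fun w => K * (X_ k w - X w)).
      apply: measurable_funM => //; apply: measurable_funB => //.
      exact: coercive_meas.
    apply: le_lt_trans (truncated_momentB (mK _) (mK _)) _.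
    have := hN' _ Nn; have := hN' (m + N)%N (leq_addl _ _); lra.
  - by move=> LK K1; split => //; apply: nrm_le; rewrite ?expr1n.
have LX : L2 P X.
  have [N /(_ N (leqnn _))[LN _]] := key 1 ltr01.
  have := L2B (coercive_L2 HG (GX N)) LN.
  by congr L2; apply/funext => w; ring.
split => //; apply/cvgrPdist_le => e e0.
have [|N hN] := key e^-1; first by rewrite invr_gt0.
exists N => //= n /hN[_].
rewrite nrmZ; last by apply: L2B => //; exact: (coercive_L2 HG).
rewrite sub0r normrN (ger0_norm (nrm_ge0 _ _)) gtr0_norm ?invr_gt0//.
by rewrite mulrC ler_pdivrMr// mul1r.
Qed.

Lemma sub_seq_closure X : G X -> seq_closure G X.
Proof. by move=> GX; exists (fun=> X); split => // w; exact: cvg_cst. Qed.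

(** The constant [c] is not degraded: the condition [truncated_moment X < c] is strict, so it holds
    eventually along the approximating sequence, and Fatou transfers the bound 1 to the limit. *)
Lemma coercive_seq_closure : coercive c (seq_closure G).
Proof.
split.
- by move=> X [X_ [GX XX]]; have [] := coercive_cvg GX XX.
- move=> a X Y [X_ [GX XX]] [Y_ [GY YY]].
  exists (fun n w => a * X_ n w + Y_ n w); split => [n|w].
    exact: (coercive_lin HG).
  by apply: cvgD (YY w); apply: cvgMr.
move=> X [X_ [GX XX]] Xc.
have mX : measurable_fun setT X.
  by apply: (@measurable_fun_cvg _ _ _ setT X_) => // n; exact: coercive_meas.
have cvgX := truncated_moment_cvg (fun n => coercive_meas (GX n)) mX XX.
have e0 : 0 < c - truncated_moment X by rewrite subr_gt0.
have /cvgrPdist_lt/(_ _ e0)[N _ hN] := cvgX.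
apply: (fatou_ip (X_ := fun n => X_ (n + N)%N) _ _ _).2 => [n|w|n].
- exact: (coercive_L2 HG).
- by rewrite (cvg_shiftn N (fun m => X_ m w)).
- apply: (coercive_bound HG) => //.
  have := hN (n + N)%N (leq_addl _ _).
  by rewrite distrC => /(le_lt_trans (ler_norm _)); rewrite ltrD2r.
Qed.

End Closure.
End CoerciveClass.

(** * Centered Gaussian variables *)

Section Density.
Context {d : measure_display} {T : measurableType d} {R : realType}.
Variables (mu nu : {measure set T -> \bar R}) (h : T -> R).
Hypotheses (h0 : forall x, 0 <= h x) (mh : measurable_fun setT h).
Hypothesis hnu : forall A, measurable A ->
  nu A = (\int[mu]_(x in A) (h x)%:E)%E.
Import HBNNSimple.

Lemma integral_density_nnsfun (f : {nnsfun T >-> R}) :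
  (\int[nu]_x (f x)%:E = \int[mu]_x ((f x)%:E * (h x)%:E))%E.
Proof.
rewrite integralT_nnsfun sintegralE.
under [RHS]eq_integral.
  move=> x xD; rewrite fimfunE -fsumEFin// ge0_mule_fsuml; last first.
    by move=> r; rewrite EFinM nnfun_muleindic_ge0.
  over.
have mh' : measurable_fun setT (EFin \o h) by exact/measurable_EFinP.
rewrite [RHS]ge0_integral_fsum//; last 2 first.
- move=> r; apply: emeasurable_funM => //.
  by apply/measurable_EFinP; exact: measurable_funM.
- move=> n x _; apply: mule_ge0; last by rewrite lee_fin.
  by rewrite EFinM nnfun_muleindic_ge0.
apply: eq_fsbigr => r /[!inE] -[x0 _ <-].
under eq_integral do rewrite EFinM -muleA.
rewrite ge0_integralZl//=; last 3 first.
- apply: emeasurable_funM => //.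
  exact/measurable_EFinP.
- by move=> x _; rewrite mule_ge0// lee_fin.
- by rewrite lee_fin.
congr (_ * _)%E; rewrite hnu// integral_mkcond; apply: eq_integral => x _.
by rewrite patchE indicE; case: ifPn => _; rewrite ?mul1e ?mul0e.
Qed.

(** Monotone convergence extends the identity from simple functions, where it reduces to [hnu] on
    each level set. *)
Lemma ge0_integral_density (f : T -> \bar R) : measurable_fun setT f ->
  (forall x, 0 <= f x)%E ->
  (\int[nu]_x f x = \int[mu]_x (f x * (h x)%:E))%E.
Proof.
move=> mf f0; pose f_ := nnsfun_approx measurableT mf.
have mh' : measurable_fun setT (EFin \o h) by exact/measurable_EFinP.
transitivity (lim (\int[nu]_x (f_ n x)%:E @[n --> \oo])%E).
  rewrite -monotone_convergence//=.
  - apply: eq_integral => ? /[!inE] xD; apply/esym/cvg_lim => //=.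
    exact: cvg_nnsfun_approx.
  - by move=> n; exact/measurable_EFinP/measurable_funTS.
  - by move=> n ? _; rewrite lee_fin.
  - by move=> ? _ ? ? mn; rewrite lee_fin; exact/lefP/nd_nnsfun_approx.
transitivity (lim (\int[mu]_x ((f_ n x)%:E * (h x)%:E) @[n --> \oo])%E).
  by apply: congr_lim; apply/funext => n /=; exact: integral_density_nnsfun.
rewrite -monotone_convergence//=.
- apply: eq_integral => x _; apply/cvg_lim => //=.
  apply: cvgeZr => //; exact: cvg_nnsfun_approx.
- move=> n; apply: emeasurable_funM => //.
  exact/measurable_EFinP/measurable_funTS.
- by move=> n x _; rewrite mule_ge0// lee_fin.
- move=> x _ a b ab; rewrite lee_pmul// ?lee_fin//.
  exact/lefP/nd_nnsfun_approx.
Qed.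

End Density.

(** * Second moments and small-ball probabilities of the normal law *)

Section Normal.
Context {R : realType}.
Implicit Types s a : R.

(** Domination by a wider normal density, so that the second moment needs only the total mass of
    that density. With [t = x^2 / (8 s^2)] the claim becomes [t <= exp(3 t) / 2], which follows from
    [1 + 3 t <= exp(3 t)]. *)
Lemma normal_pdf_sqr s x : 0 < s ->
  x ^+ 2 * normal_pdf 0 s x <= 8 * s ^+ 2 * normal_pdf 0 (2 * s) x.
Proof.
move=> s0; have s20 : 2 * s != 0 by rewrite mulf_neq0// gt_eqF.
rewrite !normal_pdfE ?gt_eqF ?mulr_gt0//= /normal_peak /normal_fun !subr0.
have -> : ((2 * s) ^+ 2 * pi *+ 2) = 2 ^+ 2 * (s ^+ 2 * pi *+ 2) :> R by ring.
rewrite sqrtrM ?sqr_ge0// sqrtr_sqr gtr0_norm// invfM.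
set p := (Num.sqrt _)^-1; have p0 : 0 <= p by rewrite invr_ge0.
have sn0 : s != 0 by rewrite gt_eqF.
set t := x ^+ 2 / (8 * s ^+ 2).
have -> : - x ^+ 2 / (s ^+ 2 *+ 2) = - (4 * t).
  by rewrite /t; field.
have -> : - x ^+ 2 / ((2 * s) ^+ 2 *+ 2) = - t.
  by rewrite /t; field.
have -> : x ^+ 2 = 8 * s ^+ 2 * t by rewrite /t; field.
have s2 := sqr_ge0 s.
have t0 : 0 <= t by apply: divr_ge0; [exact: sqr_ge0|lra].
have -> : 8 * s ^+ 2 * t * (p * expR (- (4 * t))) =
  8 * s ^+ 2 * p * (t * expR (- (4 * t))) by ring.
have -> : 8 * s ^+ 2 * (2^-1 * p * expR (- t)) =
  8 * s ^+ 2 * p * (2^-1 * expR (- t)) by ring.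
apply: ler_wpM2l; first by apply: mulr_ge0 => //; lra.
have -> : - (4 * t) = - t + - (3 * t) by ring.
rewrite expRD mulrCA mulrC ler_wpM2r ?expR_ge0// expRN.
rewrite ler_pdivrMr ?expR_gt0//.
by have := expR_ge1Dx (3 * t); lra.
Qed.

Lemma normal_second_moment s : 0 < s ->
  (\int[normal_prob 0 s]_x (x ^+ 2)%:E <= (8 * s ^+ 2)%:E)%E.
Proof.
move=> s0; have s20 : 2 * s != 0 by rewrite mulf_neq0// gt_eqF.
have m2 : measurable_fun setT (fun x : R => x ^+ 2) by exact: measurable_funX.
rewrite (@ge0_integral_density _ _ _ lebesgue_measure _ (normal_pdf 0 s))//.
- have -> : (8 * s ^+ 2)%:E = (\int[lebesgue_measure]_x
      ((8 * s ^+ 2)%:E * (normal_pdf 0 (2 * s) x)%:E))%E.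
    rewrite ge0_integralZl ?integral_normal_pdf ?mule1//.
    + by apply/measurable_EFinP; exact: measurable_normal_pdf.
    + by move=> x _; rewrite lee_fin normal_pdf_ge0.
    + by rewrite lee_fin; have := sqr_ge0 s; lra.
  apply: ge0_le_integral => //.
  + by move=> x _; rewrite -EFinM lee_fin mulr_ge0 ?sqr_ge0// normal_pdf_ge0.
  + apply/measurable_EFinP; apply: measurable_funM => //.
    exact: measurable_normal_pdf.
  + apply/measurable_EFinP; apply: measurable_funM => //.
    exact: measurable_normal_pdf.
  + by move=> x _; rewrite -!EFinM lee_fin normal_pdf_sqr.
- by move=> x; exact: normal_pdf_ge0.
- exact: measurable_normal_pdf.
- exact/measurable_EFinP.
- by move=> x; rewrite lee_fin sqr_ge0.
Qed.

(** The interval has length [2 a], and the density is at most [1 / (2 s)] because [pi] is at least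
    2. *)
Lemma normal_small_ball s a : 0 < s -> 0 <= a ->
  (normal_prob 0 s [set` `]- a, a[%R] <= (a / s)%:E)%E.
Proof.
move=> s0 a0; rewrite /normal_prob.
have peak : normal_peak s <= (2 * s)^-1.
  rewrite /normal_peak lef_pV2 ?posrE ?mulr_gt0//; last first.
    by rewrite sqrtr_gt0 mulrn_wgt0// mulr_gt0 ?pi_gt0// exprn_gt0.
  rewrite -(gtr0_norm (_ : 0 < 2 * s)) ?mulr_gt0// -sqrtr_sqr ler_wsqrtr//.
  have := pi_ge2 R; have := sqr_ge0 s; nra.
apply: (@le_trans _ _
  (\int[lebesgue_measure]_(x in [set` `]- a, a[%R]) ((2 * s)^-1)%:E)%E).
  apply: ge0_le_integral => //.
  - by move=> x _; rewrite lee_fin normal_pdf_ge0.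
  - by apply/measurable_EFinP/measurable_funTS; exact: measurable_normal_pdf.
  - move=> x _; rewrite lee_fin; apply: le_trans peak.
    by apply: normal_pdf_ub; rewrite gt_eqF.
rewrite integral_cst//= lebesgue_measure_itv/= lte_fin.
case: ifPn => _; last by rewrite mule0 lee_fin divr_ge0// ltW.
rewrite -EFinD -EFinM lee_fin opprK.
have sn0 : s != 0 by rewrite gt_eqF.
have -> : (2 * s)^-1 * (a + a) = a / s by field.
by [].
Qed.

Context {d : measure_display} {T : measurableType d} (P : probability T R).

(** One parameter [s] governs both the size of [X] and its concentration near 0. Here [s] may
    vanish, in which case the law is the Dirac mass at 0. *)
Lemma centered_gaussian_second_moment (X : T -> R) : centered_gaussian P X ->
  exists s, [/\ 0 <= s, (\int[P]_w (X w ^+ 2)%:E <= (8 * s ^+ 2)%:E)%E &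
    0 < s -> forall a, 0 <= a -> (P (X @^-1` [set` `]- a, a[%R]) <= (a / s)%:E)%E].
Proof.
move=> [mX [s [s0 Xs]]]; exists s; split => //; last first.
  by move=> sp a a0; rewrite Xs// gt_eqF//; exact: normal_small_ball.
pose Y : T -> measurableTypeR R := X.
have mY : measurable_fun setT Y by exact: mX.
have msq : measurable_fun setT (fun x : measurableTypeR R => (x ^+ 2)%:E).
  by apply/measurable_EFinP; exact: measurable_funX.
have -> : (\int[P]_w (X w ^+ 2)%:E = \int[pushforward P Y]_x (x ^+ 2)%:E)%E.
  by rewrite (ge0_integral_pushforward mY)// => x _; rewrite lee_fin sqr_ge0.
have [s00|s00] := eqVneq s 0.
  rewrite (@eq_measure_integral _ _ _ _ (\d_(0 : measurableTypeR R))).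
    by rewrite integral_dirac//= diracT mul1e s00 expr0n/= mulr0 lexx.
  by move=> A mA _; rewrite /= /pushforward Xs// s00 eqxx.
rewrite (@eq_measure_integral _ _ _ _ (normal_prob 0 s)).
  by apply: normal_second_moment; rewrite lt_neqAle eq_sym s00.
by move=> A mA _; rewrite /= /pushforward Xs// (negbTE s00).
Qed.

Lemma centered_gaussian_L2 X : centered_gaussian P X -> L2 P X.
Proof.
move=> GX; have [mX _] := GX.
have [s [_ X2 _]] := centered_gaussian_second_moment GX.
split => //; apply/integrableP; split.
  by apply/measurable_EFinP; exact: measurable_funX.
under eq_integral do rewrite /= ger0_norm ?sqr_ge0//.
exact: le_lt_trans X2 (ltry _).
Qed.

(** By contraposition. If the second moment exceeds 1, then [8 s^2 > 1] and [s > 1/3], so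
    [|X| < 1/6] has probability at most 1/2. Off that event the truncated square is at least 1/36,
    which gives a truncated moment of at least 1/72. *)
Lemma centered_gaussian_bound X : centered_gaussian P X ->
  truncated_moment P X < 72^-1 -> ip P X X <= 1.
Proof.
move=> GX; have [mX _] := GX; have LX := centered_gaussian_L2 GX.
have [s [s0 X2 XS]] := centered_gaussian_second_moment GX.
have {}X2 : ip P X X <= 8 * s ^+ 2.
  rewrite -lee_fin; apply: le_trans X2.
  by rewrite /ip /Rintegral fineK//; have [_] := LX; exact: integrable_fin_num.
apply: contraTT; rewrite -!(ltNge, leNgt) => X1.
have s3 : 3^-1 < s.
  rewrite ltNge; apply/negP => s3.
  have : s ^+ 2 <= 3^-1 ^+ 2 by rewrite ler_pXn2r// nnegrE.
  lra.
have sp : 0 < s by apply: lt_trans s3; rewrite invr_gt0.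
set B := X @^-1` `]- 6^-1, 6^-1[%classic.
have mB : measurable B by rewrite -[B]setTI; exact: mX.
have PB : (P B <= 2^-1%:E)%E.
  apply: le_trans (XS sp _ _) _ => //.
  by rewrite lee_fin ler_pdivrMr//; lra.
have iB : P.-integrable setT (EFin \o (\1_B : T -> R)).
  exact: integrable_indic.
have i1 : P.-integrable setT (EFin \o cst (1 : R)).
  exact: finite_measure_integrable_cst.
have iC : P.-integrable setT (EFin \o (fun w => 1 - \1_B w : R)).
  exact: (integrableB _ i1 iB).
apply: (@le_trans _ _ (\int[P]_w (36^-1 * (1 - \1_B w)))).
  rewrite RintegralZl// RintegralB// Rintegral_cst// mul1r.
  rewrite /Rintegral integral_indic// setIT.
  rewrite [X in fine X - _](_ : _ = 1%E) /=; last exact: probability_setT.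
  have : fine (P B) <= 2^-1.
    by rewrite -lee_fin fineK// fin_num_measure.
  lra.
apply: le_Rintegral => //.
- exact: (integrableZl _ 36^-1 iC).
- exact: integrable_trunc.
move=> w _; rewrite indicE; case: (boolP (w \in B)) => wB /=.
  by rewrite subrr mulr0 trunc_ge0.
rewrite subr0 mulr1 le_min; apply/andP; split; first by lra.
move: wB; rewrite notin_setE /B /= in_itv/= => /negP.
by rewrite negb_and -!leNgt => /orP[] ?; nra.
Qed.

End Normal.

(** * Differentiation in mean square *)

Section DerivativeInMean.
Context {R : realType} {d : measure_display} {T : measurableType d}.
Variable P : probability T R.
Variables (c : R) (G : (T -> R) -> Prop).
Hypotheses (c0 : 0 < c) (HG : coercive P c G).

Lemma derive_in_mean (V : normedModType R) (H : V -> T -> R) (z v : V) :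
  (\forall y \near z, G (H y)) -> (forall w, derivable (H ^~ w) z v) ->
  seq_closure G (fun w => 'D_v (H ^~ w) z) /\
  forall Z, L2 P Z ->
    is_derive z v (fun y => ip P Z (H y)) (ip P Z (fun w => 'D_v (H ^~ w) z)).
Proof.
move=> GH dH; set D := fun w => 'D_v (H ^~ w) z.
pose q h w := h^-1 * (H (h *: v + z) w - H z w).
have Gz : G (H z) by exact: nbhs_singleton GH.
have [e e0 Gq] : exists2 e : R, 0 < e & forall h, `|h| < e -> G (H (h *: v + z)).
  have : (fun h : R => h *: v + z) @ (0 : R) --> z.
    rewrite -[X in _ --> X]add0r -[X in X + _](scale0r v).
    by apply: cvgD (cvg_cst _); apply: cvgZr_tmp => //; exact: cvg_id.
  move=> /(_ _ GH) /nbhs_ballP[e /= e0 he]; exists e => // h hh.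
  by apply: he; rewrite /ball/= sub0r normrN.
have {}Gq h : `|h| < e -> G (q h).
  by move=> /Gq Gh; apply: (coerciveZ HG); exact: (coerciveB HG).
have qD w : (q ^~ w) @ 0^' --> D w by exact: dH.
(* Quotients are known to be in [G] only for steps shorter than [e], so each sequence of steps is
   shifted past finitely many terms. *)
have seqN (u : R^nat) : (forall n, u n != 0) /\ u @ \oo --> (0 : R) ->
    exists N, (forall n, G (q (u (n + N)%N))) /\
      forall w, q (u (n + N)%N) w @[n --> \oo] --> D w.
  move=> [un0 u0]; have /cvgrPdist_lt/(_ _ e0)[N _ hN] := u0.
  exists N; split.
    by move=> n; apply: Gq; have := hN (n + N)%N (leq_addl _ _); rewrite /= sub0r normrN.
  move=> w; rewrite (cvg_shiftn N (fun n => q (u n) w)).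
  by move/cvgr_dnbhsP: (qD w); apply.
have LD : seq_closure G D.
  have [|N [GN cN]] := seqN (fun n => n.+1%:R^-1).
    by split => [n|]; [rewrite invr_eq0 pnatr_eq0|exact: cvg_harmonic].
  by exists (fun n => q (n + N)%N.+1%:R^-1).
split => // Z LZ.
have LG X : G X -> L2 P X := coercive_L2 HG (X := X).
have LD2 : L2 P D.
  by have := coercive_L2 (coercive_seq_closure c0 HG) LD.
have lim : (fun h => h^-1 *: (((fun y => ip P Z (H y)) \o shift z) (h *: v)
    - ip P Z (H z))) @ (0 : R)^' --> ip P Z D.
  apply/cvgr_dnbhsP => u hu; have [N [GN cN]] := seqN u hu.
  rewrite -(cvg_shiftn N); have [_ cq] := coercive_cvg c0 HG GN cN.
  have /cvgrPdist_lt/(_ _ e0)[N1 _ hN1] := hu.2.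
  apply/cvgrPdist_le => a a0.
  (* The added 1 keeps the divisor positive when [Z] has norm zero. *)
  have b0 : 0 < a / (nrm P Z + 1) by rewrite divr_gt0// ltr_pwDr// nrm_ge0.
  have /cvgrPdist_le/(_ _ b0) := cq; apply: filterS2 (nbhs_infty_ge N1) => n Nn.
  rewrite sub0r normrN ger0_norm ?nrm_ge0// => hn.
  have GHu : G (H (u (n + N)%N *: v + z)).
    have := GN n => /(coerciveZ HG (u (n + N)%N)) h.
    have := coercive_lin HG 1 h Gz; congr G; apply/funext => w.
    by rewrite /q mul1r mulrA mulfV ?(hu.1)// mul1r subrK.
  rewrite distrC [X in `|X - _|](_ : _ = ip P Z (q (u (n + N)%N))); last first.
    rewrite /q ipZr//; last by apply: L2B; exact: LG.
    by rewrite ipBr//; exact: LG.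
  rewrite -ipBr//; last exact/LG/GN.
  apply: le_trans (ip_cauchy_schwarz LZ _) _.
    by apply: L2B => //; exact/LG/GN.
  apply: (@le_trans _ _ (nrm P Z * (a / (nrm P Z + 1)))).
    by apply: ler_wpM2l => //; exact: nrm_ge0.
  rewrite mulrCA; apply: ler_piMr; first exact: ltW.
  by rewrite ler_pdivrMr ?mul1r ?lerDl// ltr_pwDr// nrm_ge0.
apply: DeriveDef; first by apply/cvg_ex; exists (ip P Z D).
exact: cvg_lim lim.
Qed.

(** Pairing with [Z = Q 1 - Q 0] makes the path scalar. The mean value theorem gives
    [ip Z Z = ip Z (dQ x)] for some [x], and Cauchy-Schwarz bounds this by [nrm Z * B]. *)
Lemma mean_value_in_mean (Q dQ : R -> T -> R) (B : R) :
  (forall s : R, 0 <= s <= 1 -> \forall t \near s, G (Q t)) ->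
  (forall (s : R) w, 0 <= s <= 1 -> is_derive s (1 : R) (Q ^~ w) (dQ s w)) ->
  (forall s : R, 0 <= s <= 1 -> nrm P (dQ s) <= B) ->
  nrm P (fun w => Q 1 w - Q 0 w) <= B.
Proof.
move=> GQ dQP dQB.
have dQE s : 0 <= s <= 1 -> (fun w => 'D_1 (Q ^~ w) s) = dQ s.
  by move=> s01; apply/funext => w; have := dQP s w s01 => /@derive_val.
have GQs s : 0 <= s <= 1 -> G (Q s) by move=> /GQ; exact: nbhs_singleton.
have LQ s : 0 <= s <= 1 -> L2 P (Q s) by move=> /GQs; exact: (coercive_L2 HG).
have h1 s : 0 <= s <= 1 -> L2 P (dQ s) /\ forall Z, L2 P Z ->
    is_derive s (1 : R) (fun y => ip P Z (Q y)) (ip P Z (dQ s)).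
  move=> s01; have [||] := derive_in_mean (H := Q) (z := s) (v := 1).
  - exact: GQ.
  - by move=> w; have [] := dQP s w s01.
  rewrite dQE// => CdQ dip; split => //.
  exact: (coercive_L2 (coercive_seq_closure c0 HG)).
have i0 : 0 <= (0 : R) <= 1 by rewrite lexx ler01.
have i1 : 0 <= (1 : R) <= 1 by rewrite lexx ler01.
pose Z := fun w => Q 1 w - Q 0 w.
have LZ : L2 P Z by apply: L2B; exact: LQ.
have [||x x01 E] := @MVT R (fun s => ip P Z (Q s)) (fun s => ip P Z (dQ s)) 0 1 ltr01.
- move=> s; rewrite in_itv/= => /andP[s0 s1].
  by have [|_] := h1 s; [rewrite !ltW|exact].
- apply: derivable_within_continuous => s; rewrite in_itv/= => s01.
  by have [_ /(_ Z LZ)[]] := h1 s s01.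
have {}x01 : 0 <= x <= 1 by move: x01; rewrite in_itv/= => /andP[? ?]; rewrite !ltW.
have {}E : ip P Z Z = ip P Z (dQ x).
  by rewrite {2}/Z ipBr ?E ?subr0 ?mulr1//; exact: LQ.
have : nrm P Z ^+ 2 <= nrm P Z * B.
  rewrite sqr_nrm E; apply: le_trans (ler_norm _) _.
  apply: le_trans (ip_cauchy_schwarz LZ (h1 x x01).1) _.
  by apply: ler_wpM2l (dQB x x01); exact: nrm_ge0.
(* Cancelling [nrm Z] requires it to be nonzero; otherwise it suffices that [B] is nonnegative. *)
have := nrm_ge0 P Z; rewrite le_eqVlt => /orP[/eqP <- _|Z0].
  by apply: le_trans (dQB 0 i0); exact: nrm_ge0.
by rewrite expr2 ler_pM2l.
Qed.

End DerivativeInMean.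

Lemma is_derive_line {R : realType} {V : normedModType R} (f : V -> R)
    (a v : V) (s : R) : differentiable f (a + s *: v) ->
  is_derive s (1 : R) (fun t => f (a + t *: v)) ('D_v f (a + s *: v)).
Proof.
move=> df; have dv : derivable f (a + s *: v) v by exact: diff_derivable.
have E : (fun h : R => h^-1 *: (((fun t => f (a + t *: v)) \o shift s) (h *: 1)
      - f (a + s *: v))) =
    (fun h : R => h^-1 *: ((f \o shift (a + s *: v)) (h *: v) - f (a + s *: v))).
  apply/funext => h /=; congr (_ *: (f _ - _)).
  by rewrite -[h *: 1]/(h * 1) mulr1 scalerDl addrCA.
apply: DeriveDef; first by rewrite /derivable E.
by rewrite /derive E.
Qed.

(** * Quadratic forms and Schur complements *)

Section QuadraticForms.
Context {R : realType}.

Lemma quadfE k (eta : 'rV[R]_k) (A : 'M[R]_k) :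
  quadf eta A = \sum_i \sum_j eta 0 i * A i j * eta 0 j.
Proof.
rewrite /quadf mxE exchange_big /=; apply: eq_bigr => j _.
by rewrite !mxE big_distrl.
Qed.

(** The first block of the row vector is chosen so that its product with the block matrix vanishes
    on the first block of columns. For covariances it is minus the regression coefficient of [F(y)]
    on [F(x)]. *)
Lemma quadf_schur m1 m2 (A : 'M[R]_m1) (B : 'M[R]_(m1, m2)) (C : 'M[R]_(m2, m1))
    (D : 'M[R]_m2) (v : 'rV[R]_m2) : A \in unitmx ->
  quadf v (D - C *m invmx A *m B) =
  quadf (row_mx (- (v *m C *m invmx A)) v) (block_mx A B C D).
Proof.
move=> uA; rewrite /quadf mul_row_block tr_row_mx mul_row_col.
rewrite !mulNmx mulmxKV// addNr mul0mx add0r; congr ((_ *m _) 0 0).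
by rewrite mulmxBr !mulmxA addrC.
Qed.

Lemma det_block_schur m1 m2 (A : 'M[R]_m1) (B : 'M[R]_(m1, m2))
    (C : 'M[R]_(m2, m1)) (D : 'M[R]_m2) : A \in unitmx ->
  \det (block_mx A B C D) = \det A * \det (D - C *m invmx A *m B).
Proof.
move=> uA.
have -> : block_mx A B C D =
    block_mx 1%:M 0 (C *m invmx A) 1%:M *m block_mx A B 0 (D - C *m invmx A *m B).
  rewrite mulmx_block !mul1mx !mul0mx !addr0 mulmxKV//.
  by rewrite addrC subrK.
by rewrite det_mulmx det_lblock det_ublock !det1 !mul1r.
Qed.

Definition sqnorm k (v : 'rV[R]_k) : R := \sum_i v 0 i ^+ 2.

Lemma sqnorm_ge0 k (v : 'rV[R]_k) : 0 <= sqnorm v.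
Proof. by apply: sumr_ge0 => i _; rewrite sqr_ge0. Qed.

Lemma sqnorm_row_mx m1 m2 (u : 'rV[R]_m1) (v : 'rV[R]_m2) :
  sqnorm (row_mx u v) = sqnorm u + sqnorm v.
Proof.
rewrite /sqnorm big_split_ord /=; congr (_ + _); apply: eq_bigr => i _.
  by rewrite row_mxEl.
by rewrite row_mxEr.
Qed.

(* Schur complements inherit coercivity, so the determinant can be peeled off
   one diagonal entry at a time; no symmetry is needed. *)
Lemma det_ge_exp k (A : 'M[R]_k) (lam : R) : 0 < lam ->
  (forall v, lam * sqnorm v <= quadf v A) -> lam ^+ k <= \det A.
Proof.
move=> lam0; elim: k A => [|k IH] A HA; first by rewrite det_mx00 expr0.
pose A' : 'M[R]_(1 + k) := A.
have {}HA : forall v : 'rV[R]_(1 + k), lam * sqnorm v <= quadf v A' by [].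
change (lam ^+ k.+1 <= \det A'); rewrite -(submxK A') in HA *.
set a := ulsubmx A' in HA *; set B := ursubmx A' in HA *.
set C := dlsubmx A' in HA *; set D := drsubmx A' in HA *.
have a0 : lam <= a 0 0.
  have := HA (row_mx 1%:M 0); rewrite sqnorm_row_mx /sqnorm big_ord1 mxE expr1n.
  rewrite big1 ?addr0 ?mulr1; last by move=> i _; rewrite mxE expr0n.
  rewrite /quadf mul_row_block tr_row_mx mul_row_col !mul1mx !mul0mx !addr0.
  by rewrite trmx0 mulmx0 addr0 trmx1 mulmx1.
have ua : a \in unitmx.
  by rewrite unitmxE det_mx11 unitfE gt_eqF// (lt_le_trans lam0).
rewrite det_block_schur// det_mx11 exprS.
apply: ler_pM => //; rewrite ?(ltW lam0) ?exprn_ge0 ?(ltW lam0)//.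
apply: IH => v; rewrite quadf_schur//; apply: le_trans (HA _).
rewrite sqnorm_row_mx ler_pM2l// lerDr; exact: sqnorm_ge0.
Qed.

Lemma sqr_enorm k (v : 'rV[R]_k) : enorm v ^+ 2 = sqnorm v.
Proof. by rewrite sqr_sqrtr// sqnorm_ge0. Qed.

Lemma enorm_ge0 k (v : 'rV[R]_k) : 0 <= enorm v.
Proof. exact: sqrtr_ge0. Qed.

Lemma enormN k (u v : 'rV[R]_k) : enorm (u - v) = enorm (v - u).
Proof.
by congr Num.sqrt; apply: eq_bigr => j _; rewrite !mxE -sqrrN opprB.
Qed.

Lemma le_enorm k (v : 'rV[R]_k) j : `|v 0 j| <= enorm v.
Proof.
rewrite -sqrtr_sqr ler_wsqrtr// (bigD1 j)//= lerDl.
by apply: sumr_ge0 => i _; rewrite sqr_ge0.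
Qed.

End QuadraticForms.

(** * Mixed partial derivatives on a cube *)

Section MixedDerivatives.
Context {R : realType} {n : nat}.
Implicit Types (f h : 'rV[R]_n -> R) (k l : 'I_n).

Lemma Dalpha_foldr0 (alpha : 'I_n -> nat) h (s : seq 'I_n) :
  (forall j, j \in s -> alpha j = 0%N) ->
  foldr (fun j h => iter (alpha j) (pd j) h) h s = h.
Proof.
elim: s => //= a s IH H; rewrite H ?mem_head//= IH// => j js.
by apply: H; rewrite in_cons js orbT.
Qed.

(** [Dalpha] folds over the increasing enumeration with the smallest index outermost, so a
    multi-index yields mixed derivatives in this order only. Keeping [l <= k] throughout avoids any
    appeal to the symmetry of second derivatives. *)
Lemma Dalpha_pair l k h : (l <= k)%N ->
  Dalpha (fun j => ((j == l) + (j == k))%N) h = pd l (pd k h).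
Proof.
move=> lk; set alpha := fun j => _; rewrite /Dalpha.
have al0 j : j != l -> j != k -> alpha j = 0%N.
  by rewrite /alpha => /negbTE-> /negbTE->.
(* The tail of the enumeration beyond [l] contributes the single derivative in [k]. *)
have one s : uniq s -> l \notin s -> k \in s ->
    foldr (fun j h => iter (alpha j) (pd j) h) h s = pd k h.
  elim: s => //= a s IH /andP[aS us]; rewrite !in_cons negb_or eq_sym.
  move=> /andP[al ls]; have [ak _|ak /= ks] := eqVneq k a.
    rewrite -ak Dalpha_foldr0 => [|j js]; last first.
      apply: al0; first by apply: contraNneq ls => <-.
      by apply: contraNneq aS => jk; rewrite -ak -jk.
    by rewrite /alpha eqxx ak (negbTE al).
  by rewrite IH// (al0 a)// eq_sym.
have : pairwise (fun a b : 'I_n => (a < b)%N) (enum 'I_n).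
  rewrite -(pairwise_map val ltn) val_enum_ord -sorted_pairwise ?iota_ltn_sorted//.
  exact: ltn_trans.
have : l \in enum 'I_n by rewrite mem_enum.
have : k \in enum 'I_n by rewrite mem_enum.
elim: (enum 'I_n) => //= a s IH ks ls /andP[/allP aS pS].
have us : uniq s.
  by apply: (pairwise_uniq _ pS) => x; rewrite ltnn.
have as_ : a \notin s by apply/negP => /aS; rewrite ltnn.
move: ls; rewrite in_cons; have [la _|la /= ls] := eqVneq l a; last first.
  have al := aS _ ls; rewrite (al0 a).
  - apply: IH => //; move: ks; rewrite in_cons => /orP[/eqP ka|//].
    by move: al; rewrite -ka ltnNge lk.
  - by rewrite eq_sym.
  - by apply: contraTneq al => ->; rewrite -leqNgt.
rewrite -la in as_ *.
move: ks; rewrite in_cons -la; have [kl _|kl /= ks] := eqVneq k l.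
  rewrite Dalpha_foldr0 => [|j js]; first by rewrite /alpha kl eqxx.
  by apply: al0; rewrite ?kl; apply: contraNneq as_ => <-.
by rewrite one// /alpha eqxx eq_sym (negbTE kl).
Qed.

Lemma mi_order_pair l k : mi_order (fun j => ((j == l) + (j == k))%N) = 2%N.
Proof.
have one (a : 'I_n) : (\sum_j (j == a) = 1)%N.
  by rewrite (bigD1 a)//= eqxx big1 ?addn0// => j /negbTE->.
by rewrite /mi_order big_split /= !one.
Qed.

Lemma cube_near (r : R) x : cube r x -> \forall y \near x, cube (n := n) r y.
Proof.
move=> Ux; apply: (@filter_forall _ _ (fun j (y : 'rV[R]_n) => - r < y 0 j < r) (nbhs x)) => j.
have cj : {for x, continuous (fun y : 'rV[R]_n => y 0 j)} by exact: coord_continuous.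
have xj : x 0 j \in `]- r, r[ by rewrite in_itv/=; exact: Ux.
have : \forall y \near x, (y : 'rV[R]_n) 0 j \in `]- r, r[.
  exact: cj _ (near_in_itvoo xj).
by apply: filterS => y /=; rewrite in_itv.
Qed.

Lemma pd_eq_in_cube (r : R) f h k x : (forall y, cube r y -> f y = h y) ->
  cube r x -> pd k f x = pd k h x.
Proof.
move=> fh Ux; apply: near_eq_derive.
by apply: filterS (cube_near Ux) => y; exact: fh.
Qed.

Lemma cube_line (r s : R) x v : cube r x -> cube r (x + v) -> 0 <= s <= 1 ->
  cube (n := n) r (x + s *: v).
Proof.
move=> Ux Uxv /andP[s0 s1] j; have /andP[a b] := Ux j.
have := Uxv j; rewrite !mxE => /andP[c e].
by have [v0|v0] := lerP 0 (v 0 j); apply/andP; split; nra.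
Qed.

Lemma line_near (r s : R) x v : cube r (x + s *: v) ->
  \forall t \near s, cube (n := n) r (x + t *: v).
Proof.
move=> Us; have : (fun t : R => x + t *: v) @ s --> x + s *: v.
  by apply: cvgD (cvg_cst _) _; apply: cvgZr_tmp; exact: cvg_id.
by move=> /(_ _ (cube_near Us)).
Qed.

Lemma derive_scale f x v (t : R) : differentiable f x ->
  'D_(t *: v) f x = t * 'D_v f x.
Proof. by move=> df; rewrite !deriveE// linearZ. Qed.

End MixedDerivatives.

(** * Taylor estimate for a smooth Gaussian field *)

Section SmoothField.
Context {R : realType} {n m : nat} {d : measure_display} {T : measurableType d}.
Variables (P : probability T R) (r : R) (g : 'I_m -> 'rV[R]_n -> T -> R).
Local Notation U := (cube (n := n) r).
Hypothesis gG : centered_gaussian_field P U g.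
Hypothesis dg : forall i w x, U x -> differentiable (fun z => g i z w) x.
Hypothesis ddg : forall i (k : 'I_n) w x, U x ->
  differentiable (pd k (fun z => g i z w)) x.

(** The linear span of the field values. Indexed families allow repeated points, so a sum is a
    concatenation, and each member is Gaussian directly by [gG]. *)
Definition gspan : (T -> R) -> Prop := fun X =>
  exists (k : nat) (pts : 'I_k -> 'rV[R]_n) (idx : 'I_k -> 'I_m) (c : 'I_k -> R),
    (forall l, U (pts l)) /\ X = fun w => \sum_(l < k) c l * g (idx l) (pts l) w.

Lemma gspan_gaussian X : gspan X -> centered_gaussian P X.
Proof. by move=> [k [pts [idx [c [Up ->]]]]]; exact: gG. Qed.

Lemma inv72_gt0 : 0 < 72^-1 :> R. Proof. by rewrite invr_gt0. Qed.

Lemma coercive_gspan : coercive P 72^-1 gspan.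
Proof.
split.
- by move=> X /gspan_gaussian; exact: centered_gaussian_L2.
- move=> a X Y [k1 [p1 [i1 [c1 [U1 ->]]]]] [k2 [p2 [i2 [c2 [U2 ->]]]]].
  exists (k1 + k2)%N,
    (fun l : 'I_(k1 + k2) => match fintype.split l with inl l => p1 l | inr l => p2 l end),
    (fun l : 'I_(k1 + k2) => match fintype.split l with inl l => i1 l | inr l => i2 l end),
    (fun l : 'I_(k1 + k2) => match fintype.split l with inl l => a * c1 l | inr l => c2 l end).
  split; first by move=> l; case: fintype.split.
  apply/funext => w; rewrite big_split_ord /= big_distrr /=.
  congr (_ + _); apply: eq_bigr => l _.
    by rewrite -[lshift k2 l]/(unsplit (inl l)) unsplitK mulrA.
  by rewrite -[rshift k1 l]/(unsplit (inr l)) unsplitK.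
- by move=> X /gspan_gaussian; exact: centered_gaussian_bound.
Qed.

Lemma gspan_g i x : U x -> gspan (g i x).
Proof.
move=> Ux; exists 1%N, (fun=> x), (fun=> i), (fun=> 1); split => //.
by apply/funext => w; rewrite big_ord1 mul1r.
Qed.

Local Notation gspan1 := (seq_closure gspan).
Local Notation gspan2 := (seq_closure gspan1).

Lemma coercive_gspan1 : coercive P 72^-1 gspan1.
Proof. exact: coercive_seq_closure inv72_gt0 coercive_gspan. Qed.

Lemma coercive_gspan2 : coercive P 72^-1 gspan2.
Proof. exact: coercive_seq_closure inv72_gt0 coercive_gspan1. Qed.

Lemma L2_g i x : U x -> L2 P (g i x).
Proof. by move=> /(gspan_g i); exact: (coercive_L2 coercive_gspan). Qed.

(** Pathwise derivatives regarded as random variables; they lie in the first closure of [gspan], and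
    the second derivatives in the second. *)
Definition dG i k x : T -> R := fun w => pd k (fun z => g i z w) x.
Definition ddG i l k x : T -> R := fun w => pd l (pd k (fun z => g i z w)) x.

Lemma gspan_near i x : U x -> \forall y \near x, gspan (g i y).
Proof. by move=> Ux; apply: filterS (cube_near Ux) => y; exact: gspan_g. Qed.

Lemma gspan1_dG i k x : U x -> gspan1 (dG i k x).
Proof.
move=> Ux.
apply: (derive_in_mean inv72_gt0 coercive_gspan (gspan_near i Ux) _).1 => w.
by apply: diff_derivable; exact: dg.
Qed.

Lemma gspan1_near i k x : U x -> \forall y \near x, gspan1 (dG i k y).
Proof. by move=> Ux; apply: filterS (cube_near Ux) => y; exact: gspan1_dG. Qed.

Lemma L2_dG i k x : U x -> L2 P (dG i k x).
Proof. by move=> /(gspan1_dG i k); exact: (coercive_L2 coercive_gspan1). Qed.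

Lemma L2_ddG i l k x : U x -> L2 P (ddG i l k x).
Proof.
move=> Ux; apply: (coercive_L2 coercive_gspan2).
apply: (derive_in_mean inv72_gt0 coercive_gspan1 (gspan1_near i k Ux) _).1 => w.
by apply: diff_derivable; exact: ddg.
Qed.

Lemma pd_ip_g i k x Z : L2 P Z -> U x ->
  pd k (fun y => ip P Z (g i y)) x = ip P Z (dG i k x).
Proof.
move=> LZ Ux.
have [|_ /(_ Z LZ)[_ E]] := derive_in_mean inv72_gt0 coercive_gspan
  (v := ev k) (gspan_near i Ux); last exact: E.
by move=> w; apply: diff_derivable; exact: dg.
Qed.

Lemma pd_pd_ip_g i l k x Z : L2 P Z -> U x ->
  pd l (pd k (fun y => ip P Z (g i y))) x = ip P Z (ddG i l k x).
Proof.
move=> LZ Ux.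
rewrite (pd_eq_in_cube l (fun y Uy => pd_ip_g i k LZ Uy) Ux).
have [|_ /(_ Z LZ)[_ E]] := derive_in_mean inv72_gt0 coercive_gspan1
  (v := ev l) (gspan1_near i k Ux); last exact: E.
by move=> w; apply: diff_derivable; exact: ddg.
Qed.

Lemma KcovE i1 i2 x y : Kcov P g i1 i2 x y = ip P (g i1 x) (g i2 y).
Proof. by rewrite /Kcov /ip /Rintegral unlock. Qed.

Lemma Dalpha_Kcov i (l k : 'I_n) x : (l <= k)%N -> U x ->
  let alpha := fun j => ((j == l) + (j == k))%N in
  Dalpha alpha (fun x' => Dalpha alpha (fun y' => Kcov P g i i x' y') x) x =
  ip P (ddG i l k x) (ddG i l k x).
Proof.
move=> lk Ux /=; rewrite Dalpha_pair//.
have E y : U y ->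
    Dalpha (fun j => ((j == l) + (j == k))%N) (fun y' => Kcov P g i i y y') x =
    ip P (ddG i l k x) (g i y).
  move=> Uy; rewrite (Dalpha_pair _ lk) (_ : Kcov P g i i y = fun z =>
    ip P (g i y) (g i z)); last by apply/funext => z; rewrite KcovE.
  by rewrite (pd_pd_ip_g i l k (L2_g i Uy) Ux) (ipC P (g i y)).
(* The identity [E] holds on the whole open cube, so it can be differentiated twice. *)
rewrite (pd_eq_in_cube l (fun y Uy => pd_eq_in_cube k E Uy) Ux).
by rewrite (pd_pd_ip_g i l k (L2_ddG i l k Ux) Ux).
Qed.

Variable M : R.
Hypothesis gM : forall alpha : 'I_n -> nat, (mi_order alpha <= 3)%N ->
  forall i x, U x ->
  `| Dalpha alpha (fun x' => Dalpha alpha (fun y' => Kcov P g i i x' y') x) x | <= M.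
Local Notation B := (Num.sqrt M).

Lemma nrm_ddG i (l k : 'I_n) x : (l <= k)%N -> U x -> nrm P (ddG i l k x) <= B.
Proof.
move=> lk Ux; rewrite /nrm ler_wsqrtr// -Dalpha_Kcov//.
by apply: le_trans (ler_norm _) _; apply: gM => //; rewrite mi_order_pair.
Qed.

Lemma dG_increment i (l k : 'I_n) x (t : R) : (l <= k)%N ->
  U x -> U (x + t *: ev l) ->
  nrm P (fun w => dG i k (x + t *: ev l) w - dG i k x w) <= `|t| * B.
Proof.
move=> lk Ux Ut.
have Us (s : R) : 0 <= s <= 1 -> U (x + s *: (t *: ev l)) by exact: cube_line.
have := @mean_value_in_mean _ _ _ _ _ _ inv72_gt0 coercive_gspan1
  (fun s => dG i k (x + s *: (t *: ev l)))
  (fun s w => t * ddG i l k (x + s *: (t *: ev l)) w) (`|t| * B).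
rewrite scale1r scale0r addr0; apply.
- move=> s /Us Uxs; apply: filterS (line_near Uxs) => y; exact: gspan1_dG.
- move=> s w /Us Uxs; rewrite -derive_scale; last exact: ddg.
  by apply: (is_derive_line (f := pd k (fun z => g i z w))); exact: ddg.
- move=> s /Us Uxs; rewrite nrmZ; last exact: L2_ddG.
  by rewrite ler_wpM2l// nrm_ddG.
Qed.

(** The mean value inequality is applied to [g(x + s t e_k) - s t dG(x)], a path in the first
    closure. Its derivative is [t] times an increment of [dG], hence at most [|t| |s t| B] in
    norm. *)
Lemma g_increment i (k : 'I_n) x (t : R) : U x -> U (x + t *: ev k) ->
  nrm P (fun w => g i (x + t *: ev k) w - g i x w - t * dG i k x w) <= t ^+ 2 * B.
Proof.
move=> Ux Ut.
have Us (s : R) : 0 <= s <= 1 -> U (x + s *: (t *: ev k)) by exact: cube_line.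
have := @mean_value_in_mean _ _ _ _ _ _ inv72_gt0 coercive_gspan1
  (fun s w => (- (s * t)) * dG i k x w + g i (x + s *: (t *: ev k)) w)
  (fun s w => t * (dG i k (x + s *: (t *: ev k)) w - dG i k x w)) (t ^+ 2 * B).
rewrite scale1r scale0r addr0.
have -> : (fun w => - (1 * t) * dG i k x w + g i (x + t *: ev k) w -
      (- (0 * t) * dG i k x w + g i x w)) =
    (fun w => g i (x + t *: ev k) w - g i x w - t * dG i k x w).
  by apply/funext => w; ring.
apply.
- move=> s /Us Uxs; apply: filterS (line_near Uxs) => y Uy.
  apply: (coercive_lin coercive_gspan1); first exact: gspan1_dG.
  by apply: sub_seq_closure; exact: gspan_g.
- move=> s w /Us Uxs.
  have h1 := is_derive_line (dg i w Uxs).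
  have h2 : is_derive s (1 : R) (fun s : R => (- (s * t)) * dG i k x w) (- t * dG i k x w).
    have -> : (fun s : R => (- (s * t)) * dG i k x w) =
        (- t * dG i k x w) \*: (@id R).
      by apply/funext => y /=; rewrite -[RHS]/(- t * dG i k x w * y); ring.
    by apply: is_derive_eq; rewrite -[LHS]/(- t * dG i k x w * 1) mulr1.
  have := is_deriveD h2 h1; rewrite derive_scale; last exact: dg.
  by congr is_derive; rewrite /dG /pd; ring.
- move=> s s01; have Uxs := Us s s01.
  rewrite nrmZ; last by apply: L2B; exact: L2_dG.
  rewrite scalerA in Uxs *; have := dG_increment i (leqnn k) Ux Uxs.
  move=> /(ler_wpM2l (normr_ge0 t)) /le_trans; apply.
  rewrite -(real_normK (num_real t)) normrM (ger0_norm (andP s01).1) mulrA.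
  apply: ler_wpM2r; first exact: sqrtr_ge0.
  rewrite mulrCA expr2 -[leRHS]mul1r ler_wpM2r ?mulr_ge0//.
  by case/andP: s01.
Qed.

(** * Taylor estimate along a coordinate path from [x] to [y] *)

Section CoordinatePath.
Variables x y : 'rV[R]_n.
Hypotheses (Ux : U x) (Uy : U y).
Local Notation e := (enorm (y - x)).

(** Coordinates are moved in increasing order. When coordinate [k] moves, only smaller ones have
    changed, so only the mixed derivatives [ddG i l k] with [l <= k] occur. *)
Definition staircase (a : nat) : 'rV[R]_n :=
  \row_j (if (j < a)%N then y 0 j else x 0 j).

Lemma staircase_in a : U (staircase a).
Proof. by move=> j; rewrite mxE; case: ifP => _; [exact: Uy|exact: Ux]. Qed.

Lemma staircase0 : staircase 0 = x.
Proof. by apply/rowP => j; rewrite mxE. Qed.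

Lemma staircaseT : staircase n = y.
Proof. by apply/rowP => j; rewrite mxE ltn_ord. Qed.

Lemma staircaseS (k : 'I_n) :
  staircase k.+1 = staircase k + (y - x) 0 k *: ev k.
Proof.
apply/rowP => j; rewrite !mxE eqxx /= ltnS leq_eqVlt.
have [->|jk] := eqVneq j k; first by rewrite eqxx ltnn /= mulr1 addrC subrK.
by rewrite (inj_eq val_inj) (negbTE jk) /= mulr0 addr0.
Qed.

Lemma dG_staircase i (k : 'I_n) a : (a <= k)%N ->
  nrm P (fun w => dG i k (staircase a) w - dG i k x w) <= a%:R * (e * B).
Proof.
have B0 : 0 <= B by exact: sqrtr_ge0.
elim: a => [_|a IH ak].
  rewrite staircase0 mul0r; apply: nrm_le => //.
  rewrite /ip; under eq_Rintegral do rewrite subrr mul0r.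
  by rewrite Rintegral_cst// mul0r expr0n.
have an : (a < n)%N by exact: ltn_trans ak (ltn_ord k).
pose l := Ordinal an; have lk : (l <= k)%N by exact: ltnW.
have h := dG_increment i (t := (y - x) 0 l) lk (staircase_in a).
rewrite -[_ a + _](staircaseS l) in h; have {}h := h (staircase_in _).
have -> : (fun w => dG i k (staircase a.+1) w - dG i k x w) =
    (fun w => (dG i k (staircase a.+1) w - dG i k (staircase a) w)
      + (dG i k (staircase a) w - dG i k x w)).
  by apply/funext => w; ring.
apply: le_trans (nrmD _ _) _; try by apply: L2B; apply: L2_dG => //; exact: staircase_in.
rewrite -natr1 mulrDl mul1r addrC; apply: lerD; first exact: IH (ltnW ak).
by apply: le_trans h _; apply: ler_wpM2r => //; exact: le_enorm.
Qed.

(** Each step costs two errors: [e^2 B] from [g_increment] at the current corner, and at most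
    [n e^2 B] for replacing the derivative there by the one at [x]. Together they give the factor
    [n.+1]. *)
Lemma g_staircase i a : (a <= n)%N ->
  nrm P (fun w => g i (staircase a) w - g i x w
    - \sum_(j < n | (j < a)%N) (y - x) 0 j * dG i j x w)
  <= a%:R * (n.+1%:R * (e ^+ 2 * B)).
Proof.
have B0 : 0 <= B by exact: sqrtr_ge0.
elim: a => [_|a IH an].
  rewrite staircase0 mul0r; apply: nrm_le => //.
  rewrite /ip; under eq_Rintegral do rewrite subrr big1// subr0 mul0r.
  by rewrite Rintegral_cst// mul0r expr0n.
pose k := Ordinal an; set v := (y - x) 0 k.
have h1 := g_increment i (k := k) (t := v) (staircase_in a).
rewrite -[_ a + _](staircaseS k) in h1; have {}h1 := h1 (staircase_in _).
have h2 := dG_staircase i (leqnn k).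
have -> : (fun w => g i (staircase a.+1) w - g i x w
    - \sum_(j < n | (j < a.+1)%N) (y - x) 0 j * dG i j x w) =
  (fun w => (g i (staircase a) w - g i x w
     - \sum_(j < n | (j < a)%N) (y - x) 0 j * dG i j x w) +
   ((g i (staircase a.+1) w - g i (staircase a) w - v * dG i k (staircase a) w) +
   v * (dG i k (staircase a) w - dG i k x w))).
  apply/funext => w; rewrite (bigD1 k)//= -/v.
  rewrite (eq_bigl (fun j : 'I_n => (j < a)%N)); first by ring.
  move=> j; rewrite ltnS leq_eqVlt -(inj_eq val_inj) /=.
  by have [->|_] := eqVneq; rewrite ?ltnn// andbT.
have Lg b : L2 P (g i (staircase b)) by exact: L2_g (staircase_in b).
have Ld j b : L2 P (dG i j (staircase b)) by exact: L2_dG (staircase_in b).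
have Lx : L2 P (g i x) by exact: L2_g.
have Ldx j : L2 P (dG i j x) by exact: L2_dG.
have L1 : L2 P (fun w => g i (staircase a.+1) w - g i (staircase a) w
    - v * dG i k (staircase a) w).
  by apply: L2B (L2Z _ _); [apply: L2B|].
have L3 : L2 P (fun w => v * (dG i k (staircase a) w - dG i k x w)).
  by apply: L2Z; apply: L2B.
have L4 : L2 P (fun w => g i (staircase a) w - g i x w
     - \sum_(j < n | (j < a)%N) (y - x) 0 j * dG i j x w).
  by apply: L2B; [apply: L2B|apply: L2_sum => j; apply: L2Z].
apply: le_trans (nrmD L4 (L2D L1 L3)) _.
rewrite -natr1 mulrDl mul1r; apply: lerD; first exact: IH (ltnW an).
apply: le_trans (nrmD L1 L3) _; rewrite nrmZ; last by apply: L2B.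
have ve : `|v| <= e by exact: le_enorm.
have e0 : 0 <= e by exact: enorm_ge0.
rewrite -natr1 mulrDl mul1r addrC; apply: lerD.
  apply: (@le_trans _ _ (e * (n%:R * (e * B)))).
    apply: ler_pM => //; first exact: nrm_ge0.
    apply: le_trans h2 _; apply: ler_wpM2r; first exact: mulr_ge0.
    by rewrite ler_nat ltnW.
  by rewrite le_eqVlt; apply/orP; left; apply/eqP; ring.
apply: le_trans h1 _; apply: ler_wpM2r => //.
by rewrite -(real_normK (num_real v)) ler_pXn2r ?nnegrE.
Qed.

Lemma taylor_in_mean i :
  nrm P (fun w => g i y w - g i x w - \sum_(j < n) (y - x) 0 j * dG i j x w)
  <= n%:R * (n.+1%:R * (e ^+ 2 * B)).
Proof.
have := g_staircase i (leqnn n); rewrite staircaseT.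
congr (nrm P _ <= _); apply/funext => w; congr (_ - _).
by apply: eq_bigl => j; rewrite ltn_ord.
Qed.

End CoordinatePath.
End SmoothField.

(** * The two-point lower bound *)

Section HilbertEstimate.
Context {R : realType} {d : measure_display} {T : measurableType d}.
Variable P : probability T R.

Lemma ip_sum_sum k (eta : 'rV[R]_k) (X : 'I_k -> T -> R) (A : 'M[R]_k) :
  (forall i, L2 P (X i)) -> (forall i j, A i j = ip P (X i) (X j)) ->
  quadf eta A = ip P (fun w => \sum_i eta 0 i * X i w)
                     (fun w => \sum_i eta 0 i * X i w).
Proof.
move=> LX AE; have LeX i : L2 P (fun w => eta 0 i * X i w) by exact: L2Z.
rewrite quadfE ip_sumr//; last exact: L2_sum.
rewrite exchange_big /=; apply: eq_bigr => j _.
rewrite ipC ip_sumr//; apply: eq_bigr => i _.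
rewrite ipZr// ipC ipZr// AE; ring.
Qed.

(** Expand the squared norm of [X / 2 + 2 Y]. The weights keep 3/4 of the main term, leaving room
    above 1/2 for the Taylor error. *)
Lemma ip_add_ge X Y : L2 P X -> L2 P Y ->
  3 / 4 * ip P X X - 3 * ip P Y Y <=
  ip P (fun w => X w + Y w) (fun w => X w + Y w).
Proof.
move=> LX LY; have := ip_ge0 P (fun w => 2^-1 * X w + 2 * Y w).
have -> : (fun w => X w + Y w) = (fun w => 1 * X w + 1 * Y w).
  by apply/funext => w; rewrite !mul1r.
rewrite !ip_lin//; lra.
Qed.

Variables (m n : nat) (X Y : 'I_m -> T -> R) (D : 'I_m -> 'I_n -> T -> R).
Variables (v : 'rV[R]_n) (k1 K : R).
Hypotheses (LX : forall i, L2 P (X i)) (LY : forall i, L2 P (Y i)).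
Hypothesis LD : forall i j, L2 P (D i j).
Hypotheses (k10 : 0 <= k1) (K0 : 0 <= K).
Hypothesis nondeg : forall (eta : 'rV[R]_m) (xi : 'M[R]_(m, n)) W,
  W = (fun w => \sum_(i < m) eta 0 i * X i w +
                \sum_(i < m) \sum_(j < n) xi i j * D i j w) ->
  k1 * (sqnorm eta + \sum_(i < m) \sum_(j < n) xi i j ^+ 2) <= ip P W W.
Hypothesis taylor : forall i,
  nrm P (fun w => Y i w - X i w - \sum_(j < n) v 0 j * D i j w) <= K.

(** Replacing each [Y i] by its Taylor expansion turns [S] into a nondegenerate main part [W] plus a
    remainder [Z]. The bound is uniform in [zeta], whose contribution through [sqnorm (zeta + eta)]
    is only nonnegative. *)
Lemma two_point_lower_bound (zeta eta : 'rV[R]_m) S :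
  S = (fun w => \sum_(i < m) zeta 0 i * X i w +
                \sum_(i < m) eta 0 i * Y i w) ->
  sqnorm eta * (3 / 4 * k1 * enorm v ^+ 2 - 3 * (m%:R * K) ^+ 2) <= ip P S S.
Proof.
move=> SE.
(* The rank-one matrix of [eta] and [v]: its squared norm is the product of theirs, the source of
   the factor [enorm v ^+ 2]. *)
pose xi := \matrix_(i < m, j < n) (eta 0 i * v 0 j).
pose W := fun w => \sum_(i < m) (zeta + eta) 0 i * X i w +
                    \sum_(i < m) \sum_(j < n) xi i j * D i j w.
pose Q i := fun w => Y i w - X i w - \sum_(j < n) v 0 j * D i j w.
pose Z := fun w => \sum_(i < m) eta 0 i * Q i w.
have LQ i : L2 P (Q i).
  by apply: L2B; [exact: L2B|apply: L2_sum => j; exact: L2Z].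
have LZ : L2 P Z by apply: L2_sum => i; exact: L2Z.
have LW : L2 P W.
  apply: L2D; first by apply: L2_sum => i; exact: L2Z.
  by apply: L2_sum => i; apply: L2_sum => j; exact: L2Z.
have -> : S = fun w => W w + Z w.
  apply/funext => w; rewrite SE /W /Z -!big_split /=; apply: eq_bigr => i _.
  rewrite /Q !mxE; under eq_bigr do rewrite mxE -mulrA.
  by rewrite -big_distrr /=; ring.
apply: le_trans (ip_add_ge LW LZ).
have hW := @nondeg (zeta + eta) xi W erefl.
have xiE : \sum_(i < m) \sum_(j < n) xi i j ^+ 2 = sqnorm eta * enorm v ^+ 2.
  rewrite sqr_enorm /sqnorm big_distrl /=; apply: eq_bigr => i _.
  by rewrite big_distrr /=; apply: eq_bigr => j _; rewrite mxE exprMn.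
have hZ : ip P Z Z <= sqnorm eta * (m%:R * K) ^+ 2.
  rewrite -sqr_nrm -sqr_enorm -exprMn ler_pXn2r ?nnegrE ?nrm_ge0//; last first.
    by apply: mulr_ge0; [exact: enorm_ge0|exact: mulr_ge0].
  apply: le_trans (nrm_sum _ _) _; first by move=> i; exact: L2Z.
  apply: (@le_trans _ _ (\sum_(i < m) (enorm eta * K))).
    apply: ler_sum => i _; rewrite nrmZ//.
    by apply: ler_pM (le_enorm _ _) (taylor i) => //; exact: nrm_ge0.
  by rewrite sumr_const card_ord -[leLHS]mulr_natl mulrCA lexx.
have := sqnorm_ge0 (zeta + eta); have := sqnorm_ge0 eta => e0 ze0.
rewrite xiE in hW.
have : 0 <= k1 * sqnorm (zeta + eta) by exact: mulr_ge0.
lra.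
Qed.

End HilbertEstimate.

(** * Null sets and regularization *)

Section NullSetModification.
Context {R : realType} {d : measure_display} {T : measurableType d}.
Variables (P : probability T R) (N : set T).
Hypotheses (mN : measurable N) (PN : P N = 0%E).

(** Resetting to 0 on the null set turns almost sure smoothness of the paths into smoothness at
    every sample point, as the pointwise closures demand, without changing laws. *)
Definition modify (X : T -> R) : T -> R := fun w => if w \in N then 0 else X w.

Lemma modifyE X w : ~ N w -> modify X w = X w.
Proof. by move=> Nw; rewrite /modify memNset. Qed.

Lemma measurable_modify X : measurable_fun setT X ->
  measurable_fun setT (modify X).
Proof.
move=> mX; have -> : modify X = fun w => X w * \1_(~` N) w.
  apply/funext => w; rewrite /modify indicE in_setC.
  by case: (w \in N); rewrite ?mulr0 ?mulr1.
by apply: measurable_funM => //; apply: measurable_indic; exact: measurableC.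
Qed.

Lemma measure_eq_off_null (A B : set T) : measurable A -> measurable B ->
  A `\` N = B `\` N -> P A = P B.
Proof.
move=> mA mB AB; rewrite (measureDI P mA mN) (measureDI P mB mN) AB.
have null C : measurable C -> P (C `&` N) = 0%E.
  move=> mC; apply/eqP; rewrite eq_le measure_ge0 andbT -PN.
  by apply: le_measure; rewrite ?inE//; exact: measurableI.
by congr (_ + _)%E; exact: etrans (null _ mA) (esym (null _ mB)).
Qed.

Lemma centered_gaussian_modify X : centered_gaussian P X ->
  centered_gaussian P (modify X).
Proof.
move=> [mX [s [s0 Xs]]]; have mX' := measurable_modify mX.
split => //; exists s; split => // A mA; rewrite -Xs//.
apply: measure_eq_off_null.
- by rewrite -[X in measurable X]setTI; exact: mX'.
- by rewrite -[X in measurable X]setTI; exact: mX.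
by apply/seteqP; split => w [/= Aw Nw]; split => //; move: Aw; rewrite /= modifyE.
Qed.

Lemma integral_eq_off_null (X Y : T -> R) : measurable_fun setT X -> measurable_fun setT Y ->
  (forall w, ~ N w -> X w = Y w) ->
  (\int[P]_w (X w)%:E = \int[P]_w (Y w)%:E)%E.
Proof.
move=> mX mY XY; apply: ae_eq_integral => //.
- exact/measurable_EFinP.
- exact/measurable_EFinP.
exists N; split => // w /= h; apply: contrapT => Nw; apply: h => _.
by rewrite XY.
Qed.

Import HBNNSimple.

(* The smaller function need not be measurable: the integral of a nonnegative
   function is a supremum over simple functions below it. *)
Lemma ge0_integral_le_off_null (X Y : T -> R) : (forall w, 0 <= X w) ->
  measurable_fun setT Y -> (forall w, 0 <= Y w) ->
  (forall w, ~ N w -> X w = Y w) ->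
  (\int[P]_w (X w)%:E <= \int[P]_w (Y w)%:E)%E.
Proof.
move=> X0 mY Y0 XY; rewrite ge0_integralTE; last by move=> w; rewrite lee_fin.
apply: ge_ereal_sup => _ [h /= hX <-]; rewrite -integralT_nnsfun.
apply: ae_ge0_le_integral => //.
- by move=> w _; rewrite lee_fin.
- exact/measurable_EFinP.
- by move=> w _; rewrite lee_fin.
- exact/measurable_EFinP.
exists N; split => // w /= Hw; apply: contrapT => Nw; apply: Hw => _.
by rewrite -XY.
Qed.

End NullSetModification.

Section Congruence.
Context {R : realType} {n : nat}.

Lemma Dalpha_eq_in_cube (r : R) (alpha : 'I_n -> nat) f h :
  (forall y, cube r y -> f y = h y) ->
  forall y, cube r y -> Dalpha alpha f y = Dalpha alpha h y.
Proof.
move=> fh; rewrite /Dalpha; elim: (enum 'I_n) => //= a s IH.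
elim: (alpha a) => //= k IHk y Uy; exact: pd_eq_in_cube Uy.
Qed.

End Congruence.

(** * Schur complement and determinant bounds for a field with smooth paths *)

Section TwoPoint.
Context {R : realType} {n m : nat} {d : measure_display} {T : measurableType d}.
Variables (P : probability T R) (r M k1 : R) (g : 'I_m -> 'rV[R]_n -> T -> R).
Local Notation U := (cube (n := n) r).
Hypothesis gG : centered_gaussian_field P U g.
Hypothesis dg : forall i w x, U x -> differentiable (fun z => g i z w) x.
Hypothesis ddg : forall i (k : 'I_n) w x, U x ->
  differentiable (pd k (fun z => g i z w)) x.
Hypothesis gM : forall alpha : 'I_n -> nat, (mi_order alpha <= 3)%N ->
  forall i x, U x ->
  `| Dalpha alpha (fun x' => Dalpha alpha (fun y' => Kcov P g i i x' y') x) x | <= M.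
Hypothesis k10 : 0 < k1.
Hypothesis nondeg : forall x, U x ->
  forall (eta : 'rV[R]_m) (xi : 'M[R]_(m, n)) W,
  W = (fun w => \sum_(i < m) eta 0 i * g i x w +
                \sum_(i < m) \sum_(j < n) xi i j * dG g i j x w) ->
  sqnorm eta + \sum_(i < m) \sum_(j < n) xi i j ^+ 2 = 1 -> k1 <= ip P W W.

(** Homogeneity: divide by the square root of [q], with the zero vector treated apart. *)
Lemma nondeg_scaled x : U x ->
  forall (eta : 'rV[R]_m) (xi : 'M[R]_(m, n)) W,
  W = (fun w => \sum_(i < m) eta 0 i * g i x w +
                \sum_(i < m) \sum_(j < n) xi i j * dG g i j x w) ->
  k1 * (sqnorm eta + \sum_(i < m) \sum_(j < n) xi i j ^+ 2) <= ip P W W.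
Proof.
move=> Ux eta xi W WE; set q := _ + _.
have q0 : 0 <= q.
  rewrite addr_ge0 ?sqnorm_ge0//; apply: sumr_ge0 => i _.
  by apply: sumr_ge0 => j _; exact: sqr_ge0.
have LW : L2 P W.
  rewrite WE; apply: L2D; first by apply: L2_sum => i; apply: L2Z; exact: L2_g Ux.
  by apply: L2_sum => i; apply: L2_sum => j; apply: L2Z; exact: L2_dG Ux.
move: q0; rewrite le_eqVlt => /orP[/eqP <-|q0].
  by rewrite mulr0; exact: ip_ge0.
pose s := (Num.sqrt q)^-1.
have s2 : s ^+ 2 = q^-1 by rewrite exprVn sqr_sqrtr// ltW.
have := @nondeg x Ux (s *: eta) (s *: xi) (fun w => s * W w).
have -> : ip P (fun w => s * W w) (fun w => s * W w) = ip P W W / q.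
  rewrite ipZr//; last exact: L2Z.
  by rewrite ipC ipZr// mulrA -expr2 s2 mulrC.
rewrite ler_pdivlMr//; apply.
  apply/funext => w; rewrite WE mulrDr !big_distrr /=; congr (_ + _).
    by apply: eq_bigr => i _; rewrite mxE mulrA.
  apply: eq_bigr => i _; rewrite big_distrr /=; apply: eq_bigr => j _.
  by rewrite mxE mulrA.
have -> : sqnorm (s *: eta) = s ^+ 2 * sqnorm eta.
  by rewrite /sqnorm big_distrr; apply: eq_bigr => i _; rewrite mxE exprMn.
have -> : \sum_(i < m) \sum_(j < n) (s *: xi) i j ^+ 2 =
    s ^+ 2 * \sum_(i < m) \sum_(j < n) xi i j ^+ 2.
  rewrite big_distrr; apply: eq_bigr => i _; rewrite big_distrr.
  by apply: eq_bigr => j _; rewrite mxE exprMn.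
by rewrite -mulrDr -/q s2 mulVf// gt_eqF.
Qed.

Lemma CovE x y i j : Cov P g x y i j = ip P (g i x) (g j y).
Proof. by rewrite mxE KcovE. Qed.

(** Nondegeneracy with [xi = 0] says that [Cov P g x x] is bounded below by [k1] as a quadratic
    form. *)
Lemma det_Cov_ge x : U x -> k1 ^+ m <= \det (Cov P g x x).
Proof.
move=> Ux; apply: det_ge_exp => // v.
rewrite (ip_sum_sum (P := P) v (X := fun i => g i x)); first last.
- by move=> i j; exact: CovE.
- by move=> i; exact: L2_g Ux.
have := nondeg_scaled (eta := v) (xi := 0) Ux erefl.
rewrite [X in _ + X]big1 ?addr0; last first.
  by move=> i _; rewrite big1// => j _; rewrite mxE expr0n.
congr (_ <= ip P _ _); apply/funext => w.
  rewrite [X in _ + X]big1 ?addr0// => i _.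
  by rewrite big1// => j _; rewrite mxE mul0r.
rewrite [X in _ + X]big1 ?addr0// => i _.
by rewrite big1// => j _; rewrite mxE mul0r.
Qed.

Lemma Cov_unit x : U x -> Cov P g x x \in unitmx.
Proof.
move=> Ux; rewrite unitmxE unitfE gt_eqF//.
by apply: lt_le_trans (det_Cov_ge Ux); exact: exprn_gt0.
Qed.

Lemma schur_lower_bound x y (eta : 'rV[R]_m) : U x -> U y ->
  12 * (m%:R * (n%:R * n.+1%:R) * Num.sqrt M * enorm (y - x)) ^+ 2 <= k1 ->
  k1 / 2 * enorm (y - x) ^+ 2 * sqnorm eta <=
  quadf eta (Cov P g y y - Cov P g y x *m invmx (Cov P g x x) *m Cov P g x y).
Proof.
move=> Ux Uy small; rewrite quadf_schur; last exact: Cov_unit.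
set zeta := - (eta *m _ *m _); pose X (l : 'I_(m + m)) :=
  match fintype.split l with inl i => g i x | inr i => g i y end.
have Xl i : X (lshift m i) = g i x.
  by rewrite /X -[lshift m i]/(unsplit (inl i)) unsplitK.
have Xr i : X (rshift m i) = g i y.
  by rewrite /X -[rshift m i]/(unsplit (inr i)) unsplitK.
rewrite (ip_sum_sum (P := P) _ (X := X)); first last.
- move=> i j; rewrite -[i]splitK -[j]splitK.
  case: (fintype.split i) => a; case: (fintype.split j) => b;
  by rewrite /unsplit ?(block_mxEul, block_mxEur, block_mxEdl, block_mxEdr)
     ?Xl ?Xr CovE.
- by move=> l; rewrite /X; case: fintype.split => i; [exact: L2_g Ux|exact: L2_g Uy].
set e := enorm _ in small *; have e0 : 0 <= e by exact: enorm_ge0.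
have B0 : 0 <= Num.sqrt M by exact: sqrtr_ge0.
pose K := n%:R * (n.+1%:R * (e ^+ 2 * Num.sqrt M)).
have K0 : 0 <= K by rewrite /K !mulr_ge0 ?sqr_ge0.
pose S w := \sum_l row_mx zeta eta 0 l * X l w.
have SE : S = fun w => \sum_(i < m) zeta 0 i * g i x w +
                       \sum_(i < m) eta 0 i * g i y w.
  apply/funext => w; rewrite /S big_split_ord /=.
  by congr (_ + _); apply: eq_bigr => i _; rewrite ?row_mxEl ?row_mxEr ?Xl ?Xr.
have := two_point_lower_bound (fun i => L2_g gG i Ux) (fun i => L2_g gG i Uy)
  (fun i j => L2_dG gG dg i j Ux) (ltW k10) K0 (nondeg_scaled Ux)
  (taylor_in_mean gG dg ddg gM Ux Uy) SE.
apply: le_trans; rewrite -/e [leLHS]mulrC; apply: ler_wpM2l; first exact: sqnorm_ge0.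
have -> : (m%:R * K) ^+ 2 =
    (m%:R * (n%:R * n.+1%:R) * Num.sqrt M * e) ^+ 2 * e ^+ 2 by rewrite /K; ring.
(* The constant 12 makes the Taylor error [3 C e^2] at most [k1 e^2 / 4], and 3/4 - 1/4 leaves the
   required 1/2. *)
set C := _ ^+ 2 in small *; have := sqr_ge0 e; nra.
Qed.

Lemma det_joint_ge x y : U x -> U y ->
  12 * (m%:R * (n%:R * n.+1%:R) * Num.sqrt M * enorm (y - x)) ^+ 2 <= k1 ->
  0 < enorm (y - x) ->
  (k1 * (k1 / 2 * enorm (y - x) ^+ 2)) ^+ m <= \det (jointCov P g x y).
Proof.
move=> Ux Uy small e0; rewrite det_block_schur; last exact: Cov_unit.
have lam0 : 0 < k1 / 2 * enorm (y - x) ^+ 2.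
  by rewrite mulr_gt0 ?divr_gt0// exprn_gt0.
rewrite exprMn; apply: ler_pM.
- by apply: exprn_ge0; exact: ltW.
- by apply: exprn_ge0; exact: ltW.
- exact: det_Cov_ge.
by apply: det_ge_exp => // v; exact: schur_lower_bound.
Qed.

End TwoPoint.

(** * Transfer of the assumptions to a modification with smooth paths *)

Section Regularization.
Context {R : realType} {n m : nat} {d : measure_display} {T : measurableType d}.
Variables (P : probability T R) (r M k1 : R) (f : 'I_m -> 'rV[R]_n -> T -> R).
Local Notation U := (cube (n := n) (r + 1)).
Hypothesis fG : centered_gaussian_field P U f.
Hypothesis fA : RMk1_assumptions P r M k1 f.

Lemma measurable_field i x : U x -> measurable_fun setT (f i x).
Proof.
move=> Ux; have [+ _] := fG (k := 1) (pts := fun=> x) (fun=> i) (fun=> 1) (fun=> Ux).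
by congr measurable_fun; apply/funext => w; rewrite big_ord1 mul1r.
Qed.

Lemma common_null_set : exists N : set T, [/\ measurable N, P N = 0%E &
  forall w, ~ N w -> forall i, C3minus U (fun x => f i x w)].
Proof.
have [_ [fC _]] := fA.
have [N [mN PN sN]] : {ae P, forall w, forall i, C3minus U (fun x => f i x w)}.
  exact: filter_forall fC.
exists N; split => // w Nw; apply: contrapT => h; apply: Nw; exact: sN.
Qed.

Variable N : set T.
Hypotheses (mN : measurable N) (PN : P N = 0%E).
Hypothesis smooth : forall w, ~ N w -> forall i, C3minus U (fun x => f i x w).

Definition reg i x : T -> R := modify N (f i x).

Lemma reg_in i w : N w -> (fun z => reg i z w) = cst 0.
Proof. by move=> Nw; apply/funext => z; rewrite /reg /modify mem_set. Qed.

Lemma reg_notin i w : ~ N w -> (fun z => reg i z w) = (fun z => f i z w).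
Proof. by move=> Nw; apply/funext => z; rewrite /reg modifyE. Qed.

Let half01 : (0 : R) < (2^-1 : R) < (1 : R).
Proof. by rewrite invr_gt0 invf_lt1// ltr1n ltr0n. Qed.

Lemma differentiable_reg i w x : U x -> differentiable (fun z => reg i z w) x.
Proof.
move=> Ux; have [Nw|Nw] := pselect (N w); first by rewrite reg_in.
by rewrite reg_notin//; have [+ _ _] := smooth Nw i half01; exact.
Qed.

Lemma differentiable_pd_reg i (k : 'I_n) w x : U x ->
  differentiable (pd k (fun z => reg i z w)) x.
Proof.
move=> Ux; have [Nw|Nw] := pselect (N w).
  have -> : pd k (fun z => reg i z w) = cst 0.
    by apply/funext => z; rewrite reg_in// /pd derive_cst.
  exact: differentiable_cst.
by rewrite reg_notin//; have [_ + _] := smooth Nw i half01; exact.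
Qed.

Lemma reg_gaussian : centered_gaussian_field P U reg.
Proof.
move=> k pts idx c Up; have := centered_gaussian_modify mN PN (fG idx c Up).
congr (centered_gaussian P); apply/funext => w; rewrite /reg /modify.
case: ifP => // _; first by rewrite big1// => l _; rewrite mulr0.
Qed.

Lemma measurable_reg i x : U x -> measurable_fun setT (reg i x).
Proof. by move=> Ux; apply: measurable_modify => //; exact: measurable_field. Qed.

Lemma Kcov_reg i1 i2 x y : U x -> U y -> Kcov P f i1 i2 x y = Kcov P reg i1 i2 x y.
Proof.
move=> Ux Uy; rewrite /Kcov unlock; congr fine.
apply: (integral_eq_off_null mN PN).
- by apply: measurable_funM; exact: measurable_field.
- by apply: measurable_funM; exact: measurable_reg.
- by move=> w Nw; rewrite /reg !modifyE.
Qed.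

Lemma Cov_reg x y : U x -> U y -> Cov P f x y = Cov P reg x y.
Proof. by move=> Ux Uy; apply/matrixP => i j; rewrite !mxE Kcov_reg. Qed.

Lemma reg_bound (alpha : 'I_n -> nat) : (mi_order alpha <= 3)%N ->
  forall i x, U x -> `| Dalpha alpha (fun x' =>
    Dalpha alpha (fun y' => Kcov P reg i i x' y') x) x | <= M.
Proof.
move=> a3 i x Ux; have [_ [_ /(_ alpha a3 i i x Ux)]] := fA.
congr (`| _ | <= _); apply: Dalpha_eq_in_cube (Ux) => x' Ux'.
by apply: Dalpha_eq_in_cube (Ux) => y' Uy'; exact: Kcov_reg.
Qed.

(** Off [N] the integrand of (A1) agrees with the square of [W], but the derivatives of the original
    field are not known to be measurable. The comparison therefore goes through
    [ge0_integral_le_off_null]. *)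
Lemma reg_nondeg x : U x ->
  forall (eta : 'rV[R]_m) (xi : 'M[R]_(m, n)) W,
  W = (fun w => \sum_(i < m) eta 0 i * reg i x w +
                \sum_(i < m) \sum_(j < n) xi i j * dG reg i j x w) ->
  sqnorm eta + \sum_(i < m) \sum_(j < n) xi i j ^+ 2 = 1 -> k1 <= ip P W W.
Proof.
move=> Ux eta xi W WE unit; have [[_ [_ A1]] _] := fA.
have LW : L2 P W.
  rewrite WE; apply: L2D; apply: L2_sum => i.
    by apply: L2Z; exact: L2_g reg_gaussian _ _ Ux.
  apply: L2_sum => j; apply: L2Z.
  by apply: (L2_dG reg_gaussian) Ux => i' w' x' Ux'; exact: differentiable_reg.
rewrite -lee_fin; apply: le_trans (A1 x Ux eta xi unit) _.
rewrite /ip /Rintegral fineK; last first.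
  by apply: integrable_fin_num => //; exact: L2_mul.
rewrite unlock; apply: (ge0_integral_le_off_null mN PN).
- by move=> w; exact: sqr_ge0.
- by have [mW _] := LW; exact: measurable_funM.
- by move=> w; rewrite -expr2 sqr_ge0.
move=> w Nw; rewrite -expr2 WE; congr ((_ + _) ^+ 2).
  by apply: eq_bigr => i _; rewrite /reg modifyE.
apply: eq_bigr => i _; apply: eq_bigr => j _.
by rewrite /dG reg_notin.
Qed.

End Regularization.

Lemma cube_shift {R : realType} {n : nat} (r : R) (x y : 'rV[R]_n) :
  cube r x -> enorm (x - y) < 1 -> cube (r + 1) y.
Proof.
move=> Ux xy j; have /andP[a b] := Ux j.
have := le_lt_trans (le_enorm (x - y) j) xy; rewrite !mxE ltr_norml => /andP[c e].
by apply/andP; split; lra.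
Qed.

Lemma cube_widen {R : realType} {n : nat} (r : R) (x : 'rV[R]_n) :
  cube r x -> cube (r + 1) x.
Proof. by move=> Ux j; have /andP[a b] := Ux j; apply/andP; split; lra. Qed.

Unset Implicit Arguments.

Theorem theoremD1 (R : realType) (n m : nat) (M k1 : R) :
  (1 <= m)%N -> (m < n)%N -> 0 < k1 ->
  exists delta : R, 0 < delta < 1 /\
  exists k2 : R, 0 < k2 /\
  forall (d : measure_display) (T : measurableType d) (P : probability T R)
         (r : R) (f : 'I_m -> 'rV[R]_n -> T -> R),
    0 < r ->
    centered_gaussian_field P (cube (r + 1)) f ->
    as_continuous P (cube (r + 1)) f ->
    RMk1_assumptions P r M k1 f ->
    forall x y : 'rV[R]_n, cube r x ->
      (enorm (x - y) <= delta ->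
       forall eta : 'rV[R]_m, enorm eta = 1 ->
         k1 / 2 * enorm (y - x) ^+ 2 <=
         quadf eta (Cov P f y y - Cov P f y x *m invmx (Cov P f x x) *m Cov P f x y)) /\
      (0 < enorm (x - y) < delta ->
       \det (jointCov P f x y) != 0 /\
       density00 P f x y <= k2 / enorm (x - y) ^+ m).
Proof.
move=> _ _ k10.
pose C := m%:R * (n%:R * n.+1%:R) * Num.sqrt M.
have C0 : 0 <= C by rewrite !mulr_ge0 ?sqrtr_ge0.
have C1 : 0 < C + 1 by rewrite ltr_pwDr.
(* Chosen so that [e <= q] gives [12 (C e)^2 <= k1]; the added 1 avoids dividing by 0 when [C]
   vanishes. *)
pose q := Num.sqrt (k1 / 12) / (C + 1).
have q0 : 0 < q by rewrite divr_gt0// sqrtr_gt0 divr_gt0.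
(* The bound 1/2 keeps [y] inside the enlarged cube and [delta] below 1. *)
exists (Num.min 2^-1 q); split.
  by rewrite lt_min invr_gt0 ltr0n q0 gt_min invf_lt1// ltr1n.
have p0 : 0 < (k1 * (k1 / 2)) ^+ m by rewrite exprn_gt0// mulr_gt0// divr_gt0.
have pi0 : 0 < (pi *+ 2 : R) ^+ m by rewrite exprn_gt0// mulrn_wgt0// pi_gt0.
(* The value of the density formula at the lower bound for the joint determinant, once its factor
   [(e^2)^m] is removed. *)
exists ((pi *+ 2) ^+ m * Num.sqrt ((k1 * (k1 / 2)) ^+ m))^-1; split.
  by rewrite invr_gt0 mulr_gt0// sqrtr_gt0.
move=> d T P r f r0 fG _ fA x y xr; rewrite (enormN x y).
set e := enorm (y - x); have e0 : 0 <= e by exact: enorm_ge0.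
have Ux : cube (r + 1) x by exact: cube_widen.
have prep : e <= Num.min 2^-1 q -> cube (r + 1) y /\ 12 * (C * e) ^+ 2 <= k1.
  rewrite le_min => /andP[e2 eq]; split.
    apply: cube_shift xr _; rewrite enormN; apply: le_lt_trans e2 _.
    by rewrite invf_lt1// ltr1n.
  have : C * e <= Num.sqrt (k1 / 12).
    apply: (@le_trans _ _ ((C + 1) * e)); first by rewrite ler_wpM2r// lerDl.
    by rewrite mulrC -ler_pdivlMr.
  move=> h; have : (C * e) ^+ 2 <= k1 / 12.
    rewrite -[leRHS]sqr_sqrtr; last by rewrite divr_ge0// ltW.
    by rewrite ler_pXn2r// nnegrE ?mulr_ge0 ?sqrtr_ge0.
  lra.
have [N [mN PN smooth]] := common_null_set fA.
have gG := reg_gaussian fG mN PN.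
have dg := differentiable_reg (N := N) smooth.
have ddg := differentiable_pd_reg (N := N) smooth.
have gM := reg_bound fG fA mN PN.
have nd := reg_nondeg fG fA mN PN smooth.
split=> [/prep[Uy small] eta eta1|/andP[ep ed]].
  rewrite !(Cov_reg fG mN PN)//.
  have := schur_lower_bound gG dg ddg gM k10 nd eta Ux Uy small.
  by rewrite -sqr_enorm eta1 expr1n mulr1.
have [Uy small] := prep (ltW ed).
have jE : jointCov P f x y = jointCov P (reg f N) x y.
  by rewrite /jointCov !(Cov_reg fG mN PN).
have := det_joint_ge gG dg ddg gM k10 nd Ux Uy small ep.
rewrite -jE -/e mulrA exprMn => hdet.
have ep2 : 0 < (e ^+ 2) ^+ m by rewrite !exprn_gt0.
have det0 : 0 < \det (jointCov P f x y).
  by apply: lt_le_trans hdet; rewrite mulr_gt0.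
split; first by rewrite gt_eqF.
rewrite /density00 -invfM lef_pV2 ?posrE; last 2 first.
- by rewrite mulr_gt0// sqrtr_gt0.
- apply: mulr_gt0; last exact: exprn_gt0.
  by rewrite mulr_gt0// sqrtr_gt0.
(* The square root of [(e^2)^m] is [e^m], which is the power in the claimed density bound. *)
rewrite -mulrA ler_pM2l//; apply: le_trans (ler_wsqrtr hdet).
by rewrite sqrtrM ?(ltW p0)// exprAC sqrtr_sqr ger0_norm ?exprn_ge0// lexx.
Qed.
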